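(* Let $\{x_t\}$ be generated by the stochastic projected gradient (SPG) method described in the context with $\gamma_t=\gamma>L$ for all $t$. For any $k\ge2$, let the output $x_{R(k)}$ be randomly chosen (independently of the samples) from $\{x_1,\dots,x_{k-1}\}$ with probability mass function $$\mathbb P(x_{R(k)}=x_{t-1})=\Big(\sum_{j=2}^kW(j)\Big)^{-1}W(t),\quad t=2,\dots,k,\qquad W(t):=\tfrac{3t-2}{8\gamma}-\tfrac{tL}{4\gamma^2}.$$ Then $$\mathbb E\big[\|g_{X,R(k)}\|^2\big]\le\Big(\sum_{t=2}^k\big(\tfrac{3t-2}{8\gamma}-\tfrac{tL}{4\gamma^2}\big)\Big)^{-1}\Big[\big(\tfrac\gamma2+\tfrac L4+\tfrac{lk}{2}\big)D_X^2+\sum_{t=2}^k\big(\tfrac{7t-2}{4\gamma}-\tfrac{tL}{2\gamma^2}\big)\tfrac{\sigma^2}{b_t}+\tfrac{\sigma^2}{\gamma b_1}\Big].$$ Specifically, if $\gamma=2L$ (with $L>0$, $D_X>0$) and $b_t=\max\big\{1,\min\{\lceil\tfrac{3t\sigma^2}{4LlD_X^2}\rceil,\lceil\tfrac{3tk\sigma^2}{4L^2D_X^2}\rceil\}\big\}$ (where the first entry of the minimum is read as $+\infty$ if $l=0$), then $$\mathbb E\big[\|g_{X,R(k)}\|^2\big]\le\frac{40L^2D_X^2}{k(k-1)}+\frac{24LlD_X^2}{k-1}.$$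
   Context: $\|\cdot\|$ and $\langle\cdot,\cdot\rangle$ are Euclidean. $X\subseteq\mathbb R^n$ is a nonempty convex compact set with diameter $D_X=\max_{x,y\in X}\|x-y\|$; $f:X\to\mathbb R$ is continuously differentiable with $\|\nabla f(x)-\nabla f(y)\|\le L\|x-y\|$ for all $x,y\in X$ for some $L\ge 0$ (hence $f(x)-f(y)-\langle\nabla f(y),x-y\rangle\le\tfrac L2\|x-y\|^2$), and, for some $l\in[0,L]$, $f(x)-f(y)-\langle\nabla f(y),x-y\rangle\ge-\tfrac l2\|x-y\|^2$ for all $x,y\in X$. Stochastic oracle: given $x\in X$ it returns $\mathcal G(x,\xi)\in\mathbb R^n$, where $\xi\in\Xi$ is a random variable; the $\xi$'s generated are i.i.d. For all $x\in X$: $\mathbb E_\xi[\mathcal G(x,\xi)]=\nabla f(x)$ (unbiasedness) and $\mathbb E_\xi\|\mathcal G(x,\xi)-\nabla f(x)\|^2\le\sigma^2$ with $\sigma^2>0$ (bounded variance). SPG method: given $x_0\in X$, stepsize parameters $\gamma_t>0$ and positive integer batch sizes $b_t$, for $t=1,2,\dots$ draw i.i.d. fresh samples $\xi^t_1,\dots,\xi^t_{b_t}$, set $\hat G_t(x)=\tfrac1{b_t}\sum_{j=1}^{b_t}\mathcal G(x,\xi^t_j)$ and $x_t=\arg\min_{x\in X}\{\langle\hat G_t(x_{t-1}),x\rangle+\tfrac{\gamma_t}{2}\|x_{t-1}-x\|^2\}$. Projected gradient: $P_X(x,g,\gamma):=\gamma(x-x^+)$ with $x^+=\arg\min_{u\in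 X}\{\langle g,u\rangle+\tfrac\gamma2\|x-u\|^2\}$, and $g_{X,t}:=P_X(x_t,\nabla f(x_t),\gamma_{t+1})$. *)

(* Defs.v *)
From HB Require Import structures.
From mathcomp Require Export all_boot all_order all_algebra.
From mathcomp Require Export all_classical all_reals all_analysis.
Export Order.TTheory GRing.Theory Num.Theory.
Export numFieldNormedType.Exports.

Set Implicit Arguments.
Unset Strict Implicit.
Unset Printing Implicit Defensive.

Local Open Scope classical_set_scope.
Local Open Scope ring_scope.

(* The library norm `|x| on 'rV[R]_n is the sup norm, hence enorm. Both norms
   induce the same topology, so [compact], [open], [nbhs] are the usual ones. *)
Definition dotp (R : realType) (n : nat) (u v : 'rV[R]_n) : R :=
  \sum_(i < n) u 0 i * v 0 i.

Definition enorm (R : realType) (n : nat) (u : 'rV[R]_n) : R :=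
  Num.sqrt (dotp u u).

(* The supremum is a maximum when X is nonempty and compact. *)
Definition diameter (R : realType) (n : nat) (X : set 'rV[R]_n) : R :=
  sup [set r | exists x y, [/\ X x, X y & r = enorm (x - y)]].

(* Differentiability of a function on X at points of X, which may lie on the
   boundary: f y = f x + <gradf x, y - x> + o(|y - x|) as y tends to x in X.
   Only the values of f and gradf on X matter. *)
Definition is_gradient_on (R : realType) (n : nat) (X : set 'rV[R]_n)
    (f : 'rV[R]_n -> R) (gradf : 'rV[R]_n -> 'rV[R]_n) : Prop :=
  forall x, X x -> forall e : R, 0 < e ->
    \forall y \near within X (nbhs x),
      `|f y - f x - dotp (gradf x) (y - x)| <= e * enorm (y - x).

Definition C1_on (R : realType) (n : nat) (X : set 'rV[R]_n)
    (f : 'rV[R]_n -> R) (gradf : 'rV[R]_n -> 'rV[R]_n) : Prop :=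
  is_gradient_on X f gradf /\ {within X, continuous gradf}.

Definition lipschitz_gradient (R : realType) (n : nat) (X : set 'rV[R]_n)
    (gradf : 'rV[R]_n -> 'rV[R]_n) (L : R) : Prop :=
  forall x y, X x -> X y -> enorm (gradf x - gradf y) <= L * enorm (x - y).

Definition lower_curvature (R : realType) (n : nat) (X : set 'rV[R]_n)
    (f : 'rV[R]_n -> R) (gradf : 'rV[R]_n -> 'rV[R]_n) (l : R) : Prop :=
  forall x y, X x -> X y ->
    f x - f y - dotp (gradf y) (x - y) >= - (l / 2) * enorm (x - y) ^+ 2.

Definition is_argmin (R : realType) (T : Type) (X : set T) (phi : T -> R)
    (u : T) : Prop :=
  X u /\ forall v, X v -> phi u <= phi v.

(* xget picks an element of the set of minimizers; for X nonempty, convex and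
   compact and gamma > 0 this set is a singleton, and the default 0 is unused. *)
Definition prox_step (R : realType) (n : nat) (X : set 'rV[R]_n)
    (x g : 'rV[R]_n) (gamma : R) : 'rV[R]_n :=
  xget 0 [set u |
    is_argmin X (fun v => dotp g v + gamma / 2 * enorm (x - v) ^+ 2) u].

Definition projected_gradient (R : realType) (n : nat) (X : set 'rV[R]_n)
    (x g : 'rV[R]_n) (gamma : R) : 'rV[R]_n :=
  gamma *: (x - prox_step X x g gamma).

(* 'rV[R]_n with its Borel sigma-algebra. *)
Definition borel_rV (R : realType) (n : nat) :=
  g_sigma_algebraType (@open 'rV[R]_n).

(* mu is the law of the random variable xi on which the oracle is based. The
   Borel measurability of the oracle in (x, xi) is what makes its composition
   with random iterates a random vector. *)
Record stochastic_oracle (R : realType) (n : nat) (X : set 'rV[R]_n)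
    (gradf : 'rV[R]_n -> 'rV[R]_n) (d : measure_display)
    (Xi : measurableType d) (mu : probability Xi R)
    (G : 'rV[R]_n -> Xi -> 'rV[R]_n) (sigma : R) : Prop := StochasticOracle {
  oracle_measurable :
    measurable_fun ((X : set (borel_rV R n)) `*` [set: Xi])
      (fun p : borel_rV R n * Xi => G p.1 p.2 : borel_rV R n);
  oracle_unbiased : forall x, X x -> forall i : 'I_n,
    mu.-integrable [set: Xi] (fun z => (G x z 0 i)%:E) /\
    ('E_mu[fun z => (G x z 0 i)%R] = (gradf x 0 i)%:E)%E;
  oracle_variance : forall x, X x ->
    ('E_mu[fun z => (enorm (G x z - gradf x) ^+ 2)%R] <= (sigma ^+ 2)%:E)%E
}.

Definition mutually_independent (R : realType) (d d' : measure_display)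
    (Omega : measurableType d) (P : probability Omega R)
    (Xi : measurableType d') (I : eqType) (J : set I)
    (xi : I -> Omega -> Xi) : Prop :=
  forall (s : seq I) (A : I -> set Xi),
    uniq s -> (forall i, i \in s -> J i /\ measurable (A i)) ->
    P (\big[setI/setT]_(i <- s) (xi i @^-1` A i)) =
    (\prod_(i <- s) P (xi i @^-1` A i))%E.

Record iid (R : realType) (d d' : measure_display)
    (Omega : measurableType d) (P : probability Omega R)
    (Xi : measurableType d') (mu : probability Xi R) (I : eqType) (J : set I)
    (xi : I -> Omega -> Xi) : Prop := Iid {
  iid_measurable : forall i, J i -> measurable_fun [set: Omega] (xi i);
  iid_law : forall i, J i -> forall A : set Xi, measurable A ->
    P (xi i @^-1` A) = mu A;
  iid_indep : mutually_independent P J xi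
}.

Definition generated_sigma_algebra (d d' : measure_display)
    (Omega : measurableType d) (Xi : measurableType d') (I : Type) (J : set I)
    (xi : I -> Omega -> Xi) : set (set Omega) :=
  <<s \bigcup_(i in J) preimage_set_system setT (xi i) measurable >>.

(* (t, j) indexes the j-th sample xi^t_j drawn at iteration t. *)
Definition sample_index (b : nat -> nat) : set (nat * nat) :=
  [set i | (1 <= i.1)%N /\ (1 <= i.2 <= b i.1)%N].

Definition minibatch (R : realType) (n : nat) (Omega Xi : Type)
    (G : 'rV[R]_n -> Xi -> 'rV[R]_n) (b : nat -> nat)
    (xi : nat * nat -> Omega -> Xi) (t : nat) (x : 'rV[R]_n) (w : Omega) :
    'rV[R]_n :=
  (b t)%:R^-1 *: \sum_(1 <= j < (b t).+1) G x (xi (t, j) w).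

Fixpoint spg (R : realType) (n : nat) (Omega Xi : Type) (X : set 'rV[R]_n)
    (G : 'rV[R]_n -> Xi -> 'rV[R]_n) (gamma : nat -> R) (b : nat -> nat)
    (xi : nat * nat -> Omega -> Xi) (x0 : 'rV[R]_n) (t : nat) (w : Omega) :
    'rV[R]_n :=
  if t is s.+1 then
    let x := spg X G gamma b xi x0 s w in
    prox_step X x (minibatch G b xi s.+1 x w) (gamma s.+1)
  else x0.

Definition weight (R : realType) (gamma L : R) (t : nat) : R :=
  (3 * t%:R - 2) / (8 * gamma) - t%:R * L / (4 * gamma ^+ 2).

(* rk is the random index R(k) of the output x_{R(k)}; the event
   x_{R(k)} = x_{t-1} is read as R(k) = t - 1. *)
Record random_output (R : realType) (d d' : measure_display)
    (Omega : measurableType d) (P : probability Omega R)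
    (Xi : measurableType d') (I : Type) (J : set I) (xi : I -> Omega -> Xi)
    (W : nat -> R) (k : nat) (rk : Omega -> nat) : Prop := RandomOutput {
  output_measurable : measurable_fun [set: Omega] rk;
  output_range : forall w, (1 <= rk w <= k.-1)%N;
  output_pmf : forall t, (2 <= t <= k)%N ->
    P (rk @^-1` [set t.-1]) = ((\sum_(2 <= j < k.+1) W j)^-1 * W t)%:E;
  output_indep : forall (B : set nat) (E : set Omega),
    generated_sigma_algebra J xi E ->
    P (rk @^-1` B `&` E) = (P (rk @^-1` B) * P E)%E
}.

(* max {1, min {ceil (3 t sigma^2 / (4 L l D^2)),
                ceil (3 t k sigma^2 / (4 L^2 D^2))}},
   where the first entry of the minimum is +oo if l = 0. *)
Definition batch_rule (R : realType) (L l D sigma : R) (k t : nat) : int :=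
  let c1 := Num.ceil (3 * t%:R * sigma ^+ 2 / (4 * L * l * D ^+ 2)) in
  let c2 :=
    Num.ceil (3 * t%:R * k%:R * sigma ^+ 2 / (4 * L ^+ 2 * D ^+ 2)) in
  Num.max 1 (if l == 0 then c2 else Num.min c1 c2).

(* Main.v *)
From HB Require Import structures.
Require Import Defs.
From mathcomp Require Import ring lra measurable_realfun.

Set Implicit Arguments.
Unset Strict Implicit.
Unset Printing Implicit Defensive.

Local Open Scope classical_set_scope.
Local Open Scope ring_scope.

(** Let W(t) be the weight of x_{t-1} in the random output, delta_t the error of
    the mini-batch gradient at x_{t-1}, d_t the length of the step from x_{t-1} to
    x_t, and xs a minimizer of f on X.

    The analysis of one trajectory is deterministic.  The optimality condition
    of the proximal subproblem is tested with v = x_{t-1}, which bounds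
    f x_t - f x_{t-1}, and with v = xs, which bounds f x_t - f xs.  Taking
    t - 1 copies of the first bound and one of the second makes t (f x_t - f xs)
    and gamma/2 |xs - x_t|^2 telescope, and the quadratic upper bound on f leaves
    a negative multiple, of order t, of d_t^2.  A part of it absorbs
    t <delta_t, x_{t-1} - x_t> by Young's inequality; the rest dominates W(t)
    times the squared projected gradient at x_{t-1}, up to a multiple of
    |delta_t|^2, because the projected gradient differs from
    gamma (x_{t-1} - x_t) by at most |delta_t|.  At t = 1
    nothing can be spared for the projected gradient, which is why the sums start
    at t = 2.  This is [prox_step_progress], [late_step], [first_step] and
    [pathwise_bound]; what remains on the right of the last one is
    deterministic, or a multiple of |delta_t|^2, or <delta_t, xs - x_{t-1}>.

    In expectation the terms of the last kind vanish, since x_{t-1} is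
    independent of the samples of iteration t, and E |delta_t|^2 is at most
    sigma^2 / b_t, since the errors of distinct samples are orthogonal.  Both
    facts are instances of one freezing principle: if U and V are independent,
    then E h(U, V) is computed by integrating first over V with U fixed
    ([freeze_ge0], [freeze_eq0]).  Here V is one sample and U is the outcome
    seen through the sigma-algebra of all the other samples, for which every
    quantity that does not involve V is measurable.  Independence of that
    sigma-algebra and of V follows from the product rule for finite families by
    the pi-lambda theorem ([history_indep]).  The same principle, with V the
    random index, turns the expectation at the random output into the weighted
    mean of the expectations at x_1, ..., x_{k-1} ([output_expectation]).

    Measurability of the iterates rests on the fact that the proximal step is
    the projection of x - g / gamma on X, hence Lipschitz, and on the
    identification of Borel measurable vectors with vectors of measurable
    coordinates ([vec_measurableP]).

    For gamma = 2 L the weights sum to k (k - 1) / (16 L), and the prescribed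
    batch sizes make each noise term at most l D^2 + L D^2 / k
    ([batch_noise]). *)

(** * Euclidean geometry of row vectors *)

Section euclidean.
Context {R : realType} {n : nat}.
Implicit Types u v w : 'rV[R]_n.

Lemma dotpC u v : dotp u v = dotp v u.
Proof. by apply: eq_bigr => i _; rewrite mulrC. Qed.

Lemma dotpDl u v w : dotp (u + v) w = dotp u w + dotp v w.
Proof. by rewrite -big_split; apply: eq_bigr => i _; rewrite mxE mulrDl. Qed.

Lemma dotpZl (a : R) u v : dotp (a *: u) v = a * dotp u v.
Proof. by rewrite /dotp mulr_sumr; apply: eq_bigr => i _; rewrite mxE mulrA. Qed.

Lemma dotpNl u v : dotp (- u) v = - dotp u v.
Proof. by rewrite -scaleN1r dotpZl mulN1r. Qed.

Lemma dotpDr u v w : dotp w (u + v) = dotp w u + dotp w v.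
Proof. by rewrite dotpC dotpDl !(dotpC w). Qed.

Lemma dotpZr (a : R) u v : dotp v (a *: u) = a * dotp v u.
Proof. by rewrite dotpC dotpZl (dotpC v). Qed.

Lemma dotpNr u v : dotp v (- u) = - dotp v u.
Proof. by rewrite dotpC dotpNl (dotpC v). Qed.

Lemma dotp0r u : dotp u 0 = 0.
Proof. by rewrite /dotp big1// => i _; rewrite mxE mulr0. Qed.

Definition dotpE := (dotpDl, dotpDr, dotpZl, dotpZr, dotpNl, dotpNr).

Lemma dotp_suml (I : Type) (r : seq I) (F : I -> 'rV[R]_n) v :
  dotp (\sum_(i <- r) F i) v = \sum_(i <- r) dotp (F i) v.
Proof.
elim/big_rec2: _ => [|i x y _ <-]; last by rewrite dotpDl.
by rewrite dotpC dotp0r.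
Qed.

Lemma dotp_ge0 u : 0 <= dotp u u.
Proof. by apply: sumr_ge0 => i _; rewrite -expr2 sqr_ge0. Qed.

Lemma enorm_ge0 u : 0 <= enorm u.
Proof. exact: sqrtr_ge0. Qed.

Lemma enorm_sqr u : enorm u ^+ 2 = dotp u u.
Proof. by rewrite sqr_sqrtr// dotp_ge0. Qed.

Lemma dotp_eq0 u : dotp u u = 0 -> u = 0.
Proof.
move=> /eqP; rewrite psumr_eq0 => [/allP h|i _]; last by rewrite -expr2 sqr_ge0.
apply/rowP => i; rewrite mxE; have := h i (mem_index_enum _).
by rewrite mulf_eq0 orbb => /eqP.
Qed.

Lemma enormN u : enorm (- u) = enorm u.
Proof. by rewrite /enorm !dotpE opprK. Qed.

Lemma enormB u v : enorm (u - v) = enorm (v - u).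
Proof. by rewrite -enormN opprB. Qed.

Lemma enormZ (a : R) u : 0 <= a -> enorm (a *: u) = a * enorm u.
Proof.
move=> a0; rewrite /enorm !dotpE mulrA -expr2 sqrtrM ?sqr_ge0//.
by rewrite sqrtr_sqr ger0_norm.
Qed.

Lemma enorm_eq0 u : enorm u = 0 -> u = 0.
Proof. by move=> u0; apply: dotp_eq0; rewrite -enorm_sqr u0 expr0n. Qed.

(** The Cauchy-Schwarz inequality, from the nonnegativity of the square of
    |v| u - |u| v. *)
Lemma dotp_le_enorm u v : dotp u v <= enorm u * enorm v.
Proof.
have [v0|v0] := eqVneq (enorm v) 0.
  by rewrite v0 (enorm_eq0 v0) dotp0r mulr0.
have {}v0 : 0 < enorm v by rewrite lt_def v0 enorm_ge0.
have [u0|u0] := eqVneq (enorm u) 0.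
  by rewrite u0 (enorm_eq0 u0) dotpC dotp0r mul0r.
have {}u0 : 0 < enorm u by rewrite lt_def u0 enorm_ge0.
have := dotp_ge0 (enorm v *: u - enorm u *: v).
rewrite !dotpE -!enorm_sqr (dotpC v u).
have uv0 : 0 < enorm u * enorm v by rewrite mulr_gt0.
set a := enorm u in u0 uv0 *; set c := enorm v in v0 uv0 *; set p := dotp u v.
move=> h; have : 0 <= (2 * (a * c)) * (a * c - p) by nra.
by rewrite pmulr_rge0 ?subr_ge0// mulr_gt0.
Qed.

Lemma norm_dotp_le u v : `|dotp u v| <= enorm u * enorm v.
Proof.
by rewrite ler_norml dotp_le_enorm andbT lerNl -dotpNl -(enormN u) dotp_le_enorm.
Qed.

Lemma coord_le_enorm u i : `|u 0 i| <= enorm u.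
Proof.
rewrite -sqrtr_sqr /enorm ler_wsqrtr// /dotp (bigD1 i)//= -expr2 lerDl.
by apply: sumr_ge0 => j _; rewrite -expr2 sqr_ge0.
Qed.

Lemma enorm_le_mx_norm u : enorm u <= Num.sqrt n%:R * `|u|.
Proof.
rewrite -[`|u|]ger0_norm// -sqrtr_sqr -sqrtrM ?ler0n// ler_wsqrtr//.
rewrite /dotp -[n in n%:R]card_ord mulr_natl -sumr_const ler_sum// => i _.
rewrite -expr2 -real_normK ?num_real// lerXn2r ?nnegrE//.
rewrite [leRHS]/Num.norm /= mx_normE.
rewrite -[leLHS]nngE num_le.
exact: (le_bigmax _ (fun ij => `|u ij.1 ij.2|%:nng) (0, i)).
Qed.

Lemma mx_norm_le_enorm u : `|u| <= enorm u.
Proof.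
rewrite [leLHS]/Num.norm /= mx_normE.
have u0 : 0 <= enorm u by exact: enorm_ge0.
rewrite -[leRHS]/((NngNum u0)%:num) num_le; apply/bigmax_leP.
split => [|[i j] _]; rewrite -num_le//= (ord1 i); exact: coord_le_enorm.
Qed.

Lemma enormD_sqr_le u v :
  enorm (u + v) ^+ 2 <= 2 * enorm u ^+ 2 + 2 * enorm v ^+ 2.
Proof.
have := dotp_ge0 (u - v).
rewrite !enorm_sqr !dotpE (dotpC v u); lra.
Qed.

End euclidean.

(** * Continuity and the proximal step *)

Section continuity.
Context {R : realType}.

Lemma nbhs_enorm {n} (x : 'rV[R]_n) (e : R) : 0 < e ->
  nbhs x [set y | enorm (x - y) < e].
Proof.
move=> e0; set c := Num.sqrt n%:R + 1 :> R.
have c0 : 0 < c by rewrite ltr_wpDl// sqrtr_ge0.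
have xx : y @[y --> nbhs x] --> x by [].
have FF : Filter (nbhs x) by apply _.
apply: (filterS _ (@cvgr_dist_lt R 'rV[R]_n _ (nbhs x) FF id x xx _
  (divr_gt0 e0 c0))) => y /=.
rewrite ltr_pdivlMr//; apply: le_lt_trans.
apply: le_trans (enorm_le_mx_norm _) _; rewrite mulrC ler_wpM2l// lerDl//.
Qed.

Lemma lipschitz_continuous {n m} (h : 'rV[R]_n -> 'rV[R]_m) (C : R) :
  (forall u v, enorm (h u - h v) <= C * enorm (u - v)) -> continuous h.
Proof.
move=> hC; suff H : forall x : 'rV[R]_n, h @ x --> h x by [].
move=> x; have C1 : 0 < `|C| + 1 by rewrite ltr_wpDl.
have FF : Filter (nbhs x) by apply _.
apply/(@cvgrPdist_lt R 'rV[R]_m _ (nbhs x) FF h (h x)) => e e0.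
apply: (filterS _ (nbhs_enorm x (divr_gt0 e0 C1))) => y /=.
rewrite ltr_pdivlMr//; apply: le_lt_trans.
apply: le_trans (mx_norm_le_enorm _) _; apply: le_trans (hC _ _) _.
rewrite mulrC ler_wpM2l ?enorm_ge0// (le_trans (ler_norm _))// lerDl//.
Qed.

Lemma coord_comp_continuous {n m} (F : 'rV[R]_m -> 'rV[R]_n) i :
  continuous F -> continuous (fun x => F x 0 i : R).
Proof.
move=> cF x.
apply: (@continuous_comp _ _ _ F (fun M : 'rV[R]_n => M 0 i) x (cF x)).
exact: (@coord_continuous R 1 n 0 i (F x)).
Qed.
Lemma dotp_continuous {n m} (F H : 'rV[R]_m -> 'rV[R]_n) :
  continuous F -> continuous H -> continuous (fun x => dotp (F x) (H x) : R).
Proof.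
move=> cF cH; rewrite /dotp; elim: (index_enum _) => [|i r IH].
  by under eq_fun do rewrite big_nil; exact: cst_continuous.
under eq_fun do rewrite big_cons.
move=> x. 
have M := (@continuousM R _ (fun x => F x 0 i) (fun x => H x 0 i) x 
  (@coord_comp_continuous _ _ F i cF x) (@coord_comp_continuous _ _ H i cH x)).
exact: (@continuousD R R^o _ _ _ x M (IH x)).
Qed.

End continuity.

Section prox.
Context {R : realType} {n : nat}.
Implicit Types (X : set 'rV[R]_n) (u v w x y g : 'rV[R]_n) (gamma : R).

Lemma convex_segment X x y (s : R) :
  convex_set (M := 'rV[R]_n) X -> X x -> X y -> 0 <= s <= 1 ->
  X (x + s *: (y - x)).
Proof.
move=> cX Xx Xy s01.
rewrite (_ : _ + _ = s *: y + (1 - s) *: x); last first.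
  by rewrite scalerBl scale1r scalerBr addrCA.
case/andP: s01 => s0 s1.
by have := cX y x (Itv01 s0 s1) (mem_set Xy) (mem_set Xx); rewrite inE.
Qed.

(** Turns minimality along a segment into the first-order condition at its
    end: a is the slope and s * c the quadratic remainder. *)
Lemma ge0_of_small_slope (a c : R) : 0 <= c ->
  (forall s, 0 < s <= 1 -> 0 <= a + s * c) -> 0 <= a.
Proof.
move=> c0 h; rewrite leNgt; apply/negP => a0.
have ca : 0 < c - a by lra.
(* half the value of s at which a + s * (c - a) vanishes *)
have s01 : 0 < - a / (2 * (c - a)) <= 1.
  rewrite divr_gt0 ?ler_pdivrMr//=; lra.
have := h _ s01.
have : - a / (2 * (c - a)) * c <= - a / 2.
  rewrite mulrAC ler_pdivrMr; last lra.
  nra.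
lra.
Qed.

(** Moving from u towards v cannot decrease the objective; to first order in
    the displacement this is the claim. *)
Lemma argmin_variational X x g gamma u :
  convex_set (M := 'rV[R]_n) X -> 0 <= gamma ->
  is_argmin X (fun v => dotp g v + gamma / 2 * enorm (x - v) ^+ 2) u ->
  forall v, X v -> 0 <= dotp (g + gamma *: (u - x)) (v - u).
Proof.
move=> cX g0 [Xu um] v Xv.
apply: (@ge0_of_small_slope _ (gamma / 2 * dotp (v - u) (v - u))).
  by rewrite mulr_ge0 ?dotp_ge0 ?divr_ge0.
move=> s /andP[s0 s1].
have := um _ (convex_segment cX Xu Xv (introT andP (conj (ltW s0) s1))).
rewrite !enorm_sqr -subr_ge0.
rewrite (_ : _ - _ = s *
  (dotp (g + gamma *: (u - x)) (v - u) + s * (gamma / 2 * dotp (v - u) (v - u)))).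
  by rewrite pmulr_rge0.
rewrite !dotpE !(dotpC u x) !(dotpC v u) !(dotpC v x); lra.
Qed.

Lemma prox_stepP X x g gamma : X !=set0 -> compact X ->
  is_argmin X (fun v => dotp g v + gamma / 2 * enorm (x - v) ^+ 2)
    (prox_step X x g gamma).
Proof.
move=> X0 cX; rewrite /prox_step.
set A := (X in xget 0 X); suff : exists u, A u by move=> /(xgetPex 0).
have [] := @EVT_min_rV R n
  (fun v => dotp g v + gamma / 2 * enorm (x - v) ^+ 2) _ X0 cX.
  apply: continuous_subspaceT => v.
  under eq_fun do rewrite enorm_sqr.
  apply: (@continuousD R R^o _ (fun v => dotp g v)).
    by apply: dotp_continuous; [exact: cst_continuous|by move=> ?; exact: cvg_id].
  apply: (@continuousM R _ (fun=> gamma / 2)); first exact: cst_continuous.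
  have cB : continuous (fun v : 'rV[R]_n => x - v).
    apply: (@lipschitz_continuous _ _ _ _ 1) => u w.
    by rewrite mul1r (enormB u) opprB addrC addrA subrK.
  exact: (dotp_continuous cB cB).
move=> c; rewrite inE => Xc cm; exists c; split=> // v Xv.
by apply: cm; rewrite inE.
Qed.

Section assumptions.
Variable X : set 'rV[R]_n.
Hypotheses (X0 : X !=set0) (Xconvex : convex_set (M := 'rV[R]_n) X)
  (Xcompact : compact X).

Lemma prox_step_in x g gamma : X (prox_step X x g gamma).
Proof. by case: (prox_stepP x g gamma X0 Xcompact). Qed.

Lemma prox_step_variational x g gamma v : 0 <= gamma -> X v ->
  0 <= dotp (g + gamma *: (prox_step X x g gamma - x)) (v - prox_step X x g gamma).
Proof.
move=> g0; apply: (argmin_variational Xconvex g0).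
exact: prox_stepP.
Qed.

(** Each of the two steps is a competitor in the optimality condition of the
    other one; the sum of the two conditions and Cauchy-Schwarz give the bound. *)
Lemma prox_step_lipschitz x y g h gamma : 0 < gamma ->
  enorm (prox_step X x g gamma - prox_step X y h gamma) <=
  enorm (x - gamma^-1 *: g - (y - gamma^-1 *: h)).
Proof.
move=> g0.
have := prox_step_variational x g (ltW g0) (prox_step_in y h gamma).
have := prox_step_variational y h (ltW g0) (prox_step_in x g gamma).
set u := prox_step X x g gamma; set v := prox_step X y h gamma => hv hu.
set z := x - gamma^-1 *: g - (y - gamma^-1 *: h).
have uvz : dotp (u - v) (u - v) <= dotp z (u - v).
  rewrite -(ler_pM2l g0) -subr_ge0.
  apply: le_trans (addr_ge0 hu hv) _.
  have gK a : gamma * (gamma^-1 * a) = a by rewrite mulVKf ?gt_eqF.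
  rewrite /z !dotpE !(dotpC v u).
  have := (gK (dotp g u), gK (dotp g v), gK (dotp h u), gK (dotp h v)).
  by move=> [[[]]]; lra.
have [->|uv0] := eqVneq (enorm (u - v)) 0; first exact: enorm_ge0.
have uvgt0 : 0 < enorm (u - v) by rewrite lt_def uv0 enorm_ge0.
rewrite -(ler_pM2r uvgt0) -expr2 enorm_sqr (le_trans uvz)//.
exact: dotp_le_enorm.
Qed.

(** The proximal objective is, up to a constant, a multiple of the squared
    distance to x - g/gamma, so that the two-argument step is a function of one
    vector; its measurability then reduces to continuity. *)
Lemma prox_step_projection x g gamma : 0 < gamma ->
  prox_step X x g gamma = prox_step X (x - gamma^-1 *: g) 0 gamma.
Proof.
move=> g0; apply/eqP; rewrite -subr_eq0; apply/eqP/enorm_eq0/eqP.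
rewrite eq_le enorm_ge0 andbT (le_trans (prox_step_lipschitz _ _ _ _ g0))//.
by rewrite scaler0 subr0 subrr /enorm dotp0r sqrtr0.
Qed.

Lemma prox_step_id x gamma : 0 < gamma -> X x -> prox_step X x 0 gamma = x.
Proof.
move=> g0 Xx; apply/eqP; rewrite -subr_eq0; apply/eqP/enorm_eq0/eqP.
rewrite -sqrf_eq0 eq_le sqr_ge0 andbT enorm_sqr.
have := prox_step_variational x 0 (ltW g0) Xx.
rewrite add0r dotpZl -(opprB _ x) dotpNr mulrN oppr_ge0.
by rewrite pmulr_rle0.
Qed.

End assumptions.


End prox.

(** * Smooth functions on a convex set *)

Section smooth.
Context {R : realType}.

(** Links the epsilon form of differentiability used on X with the derivative
    of a function of one real variable. *)
Lemma first_order_is_derive (phi : R -> R) (s c : R) :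
  (forall e, 0 < e ->
    \forall t \near s, `|phi t - phi s - c * (t - s)| <= e * `|t - s|) ->
  is_derive s 1 phi c.
Proof.
move=> h.
suff H : h^-1 *: ((phi \o shift s) (h *: (1 : R)) - phi s) @[h --> 0^'] --> c.
  by split; [apply/cvg_ex; exists c|exact/cvg_lim].
apply/cvgrPdist_le => e e0.
have /nbhs_ballP[r /= r0 hr] := h _ e0.
near=> x.
have x0 : x != 0 by near: x; exact: nbhs_dnbhs_neq.
have hx : `|phi (x + s) - phi s - c * x| <= e * `|x|.
  have := hr (x + s); rewrite /= addrK; apply.
  rewrite /ball/= opprD addrCA subrr addr0 normrN.
  by near: x; exact: dnbhs0_lt.
rewrite /= scaler1 -[c](mulKf x0) -scalerBr normrZ normfV ler_pdivrMl ?normr_gt0//.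
by rewrite distrC (mulrC x) (mulrC `|x|).
Unshelve. all: by end_near. Qed.

Variable n : nat.
Implicit Types (X : set 'rV[R]_n) (x y : 'rV[R]_n).

Lemma gradient_continuous X (f : 'rV[R]_n -> R) gradf :
  is_gradient_on X f gradf -> {within X, continuous f}.
Proof.
move=> fg; apply/subspace_continuousP => x Xx.
apply/cvgrPdist_le => e e0.
have C0 : 0 < enorm (gradf x) + 1 by rewrite ltr_wpDl// enorm_ge0.
have FF : Filter (nbhs x) by apply _.
have := fg _ Xx _ ltr01; rewrite /prop_near1/within/= => h.
have h' := nbhs_enorm x (divr_gt0 e0 C0).
apply: (@filterS2 _ (nbhs x) FF _ _ _ _ h h') => y {}h /=.
rewrite ltr_pdivlMr// => {}h' Xy.
have := h Xy; rewrite mul1r (enormB y) => {}h.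
have hd : `|dotp (gradf x) (y - x)| <= enorm (gradf x) * enorm (x - y).
  by rewrite enormB norm_dotp_le.
apply: le_trans (ltW h').
rewrite -[leLHS]/(`|f x - f y|) distrC.
rewrite -(subrK (dotp (gradf x) (y - x)) (f y - f x)).
by apply: le_trans (ler_normD _ _) _; lra.
Qed.

(** On the segment from y to x subtract from f its linear part and the quadratic
    L/2 s^2 |x - y|^2: by the Lipschitz bound the derivative in s of the result is
    nonpositive, and the mean value theorem applies.  At interior points of the
    segment differentiability within X is enough, even on the boundary of X. *)
Lemma descent_lemma X (f : 'rV[R]_n -> R) gradf (L : R) :
  convex_set (M := 'rV[R]_n) X -> is_gradient_on X f gradf ->
  lipschitz_gradient X gradf L ->
  forall x y, X x -> X y ->
  f x - f y - dotp (gradf y) (x - y) <= L / 2 * enorm (x - y) ^+ 2.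
Proof.
move=> cX fg fL x y Xx Xy.
set d := x - y; pose z (s : R) := y + s *: d.
have Xz s : 0 <= s <= 1 -> X (z s) by exact: convex_segment.
have zB s t : z t - z s = (t - s) *: d.
  by rewrite /z opprD addrACA subrr add0r scalerBl.
have zs (s : R) : z @ s --> z s.
  by apply: cvgD; [exact: cvg_cst|apply: cvgZr_tmp; exact: cvg_id].
have line (s : R) : 0 <= s <= 1 -> forall e : R, 0 < e ->
    \forall t \near s, 0 <= t <= 1 ->
    `|f (z t) - f (z s) - dotp (gradf (z s)) d * (t - s)| <= e * `|t - s|.
  move=> s01 e e0.
  have d0 : 0 < enorm d + 1 by rewrite ltr_wpDl// enorm_ge0.
  have := fg _ (Xz _ s01) _ (divr_gt0 e0 d0).
  rewrite /prop_near1/within/= => h.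
  have {h}: \forall t \near s, X (z t) -> `|f (z t) - f (z s) -
      dotp (gradf (z s)) (z t - z s)| <= e / (enorm d + 1) * enorm (z t - z s).
    exact: zs _ _ h.
  apply: filterS => t h t01.
  have := h (Xz _ t01); rewrite zB dotpZr mulrC => /le_trans; apply.
  have -> : enorm ((t - s) *: d) = `|t - s| * enorm d.
    by rewrite /enorm !dotpE mulrA -expr2 sqrtrM ?sqr_ge0// sqrtr_sqr.
  have -> : e / (enorm d + 1) * (`|t - s| * enorm d) =
      e * `|t - s| * (enorm d / (enorm d + 1)) by ring.
  by rewrite ler_piMr ?mulr_ge0 ?(ltW e0)// ler_pdivrMr// mul1r lerDl.
pose psi s := f (z s) - s * dotp (gradf y) d - L / 2 * enorm d ^+ 2 * s ^+ 2.
pose dpsi s := dotp (gradf (z s)) d - dotp (gradf y) d - L * enorm d ^+ 2 * s.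
have [s s01] : exists2 s, s \in `]0, 1[%R & psi 1 - psi 0 = dpsi s * (1 - 0).
  apply: MVT => // [s s01|].
    have s01' : 0 <= s <= 1 by move: s01; rewrite in_itv/=; lra.
    have fz : is_derive s 1 (f \o z) (dotp (gradf (z s)) d).
      apply: first_order_is_derive => e e0.
      apply: filterS2 (line _ s01' _ e0) (near_in_itvoo s01) => t h.
      by rewrite in_itv/= => t01; apply: h; lra.
    have lin : is_derive s 1 (fun t : R => t * dotp (gradf y) d) (dotp (gradf y) d).
      by apply: is_derive_eq; rewrite /GRing.scale/= mulr1 mulr0 ?addr0 ?add0r.
    have quad : is_derive s 1 (fun t : R => L / 2 * enorm d ^+ 2 * t ^+ 2)
        (L * enorm d ^+ 2 * s).
      by apply: is_derive_eq; rewrite /GRing.scale/=; field.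
    exact: (is_deriveB (is_deriveB fz lin) quad).
  apply/subspace_continuousP => s; rewrite /= in_itv/= => s01.
  have cf : f (z t) @[t --> within `[0, 1] (nbhs s)] --> f (z s).
    have /subspace_continuousP/(_ _ (Xz _ s01)) cfX := gradient_continuous fg.
    move=> A /cfX; rewrite /nbhs/=/within/= => fA.
    have {}fA : \forall t \near s, X (z t) -> A (f (z t)) by exact: zs _ _ fA.
    by rewrite near_simpl; apply: filterS fA => t + t01; apply; exact: Xz.
  have cq : continuous (fun t : R => t * dotp (gradf y) d +
      L / 2 * enorm d ^+ 2 * t ^+ 2).
    move=> t; apply: cvgD; first by apply: cvgMr_tmp; exact: cvg_id.
    by apply: cvgMl_tmp; exact: exprn_continuous.
  have -> : psi = (f \o z) - (fun t : R => t * dotp (gradf y) d +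
      L / 2 * enorm d ^+ 2 * t ^+ 2).
    by apply/funext => t; rewrite /psi !fctE; ring.
  by apply: (cvgB cf); apply: cvg_within_filter; exact: cq.
rewrite /psi /dpsi /z scale0r scale1r addr0 [in f (y + d)]addrC subrK.
move: s01; rewrite in_itv/= => /andP[s0 s1].
have Xzs : X (z s) by apply: Xz; rewrite !ltW.
have zsy : z s - y = s *: d by rewrite /z addrAC subrr add0r.
have := fL _ _ Xzs Xy; rewrite zsy (enormZ _ (ltW s0)) => hL.
have := dotp_le_enorm (gradf (z s) - gradf y) d; rewrite dotpDl dotpNl => hC.
have : enorm (gradf (z s) - gradf y) * enorm d <= L * (s * enorm d) * enorm d.
  by rewrite ler_wpM2r ?enorm_ge0.
rewrite /z; lra.
Qed.

Lemma enorm_le_diameter X x y : compact X -> X x -> X y ->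
  enorm (x - y) <= diameter X.
Proof.
move=> cX Xx Xy; apply: ub_le_sup; last by exists x, y.
have [M [_ /(_ (M + 1))]] := compact_bounded cX.
rewrite ltrDl ltr01 => /(_ isT) XM.
exists (Num.sqrt n%:R * ((M + 1) + (M + 1))) => _ [u [v [Xu Xv ->]]].
apply: le_trans (enorm_le_mx_norm _) _; rewrite ler_wpM2l ?sqrtr_ge0//.
by rewrite (le_trans (ler_normB _ _))// lerD//; exact: XM.
Qed.

End smooth.

(** * One step of the method and the sum over a trajectory *)

Section one_step.
Context {R : realType} {n : nat}.
Variables (X : set 'rV[R]_n) (f : 'rV[R]_n -> R) (gradf : 'rV[R]_n -> 'rV[R]_n).
Variables (L l gamma : R).
Hypotheses (X0 : X !=set0) (Xconvex : convex_set (M := 'rV[R]_n) X)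
  (Xcompact : compact X) (fC1 : is_gradient_on X f gradf)
  (fL : lipschitz_gradient X gradf L) (fl : lower_curvature X f gradf l).
Hypotheses (L0 : 0 <= L) (l0 : 0 <= l) (Lgamma : L < gamma).

Let gamma0 : 0 < gamma. Proof. exact: le_lt_trans Lgamma. Qed.

(** The factor of |delta_t|^2 once W(t) has been fixed: 2 W(t) + t / gamma. *)
Definition noise_weight (t : nat) : R :=
  (7 * t%:R - 2) / (4 * gamma) - t%:R * L / (2 * gamma ^+ 2).

(** 8 gamma^2 W(t) = (t - 2) gamma + 2 t (gamma - L). *)
Lemma weight_gt0 t : (2 <= t)%N -> 0 < weight gamma L t.
Proof.
move=> t2.
have -> : weight gamma L t = ((3 * t%:R - 2) * gamma - 2 * t%:R * L) / (8 * gamma ^+ 2).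
  by rewrite /weight; field; rewrite gt_eqF.
apply: divr_gt0; last by rewrite mulr_gt0// exprn_gt0.
have T2 : 2 <= t%:R :> R by rewrite ler_nat.
have h1 : 0 <= (t%:R - 2) * gamma by rewrite mulr_ge0 ?subr_ge0// ltW.
have h2 : 0 < t%:R * (gamma - L) by rewrite mulr_gt0 ?subr_gt0// (lt_le_trans _ T2).
lra.
Qed.

(** Relates the exact gradient g, which defines the projected gradient, to the
    estimate h, which drives the method: by nonexpansiveness the two steps are at
    distance at most |h - g| / gamma. *)
Lemma projected_gradient_bound x g h :
  enorm (projected_gradient X x g gamma) ^+ 2 <=
  2 * gamma ^+ 2 * enorm (prox_step X x h gamma - x) ^+ 2 +
  2 * enorm (h - g) ^+ 2.
Proof.
have := prox_step_lipschitz X0 Xconvex Xcompact x x g h gamma0.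
rewrite (_ : _ - _ - _ = gamma^-1 *: (h - g)); last first.
  by rewrite scalerBr opprB addrC addrA subrK.
rewrite (@enormZ _ _ gamma^-1) ?invr_ge0 ?(ltW gamma0)// ler_pdivlMl// /projected_gradient.
set u := prox_step X x g gamma; set v := prox_step X x h gamma => uv.
have {}uv : gamma ^+ 2 * enorm (u - v) ^+ 2 <= enorm (h - g) ^+ 2.
  by rewrite -exprMn lerXn2r// nnegrE ?mulr_ge0 ?enorm_ge0 ?ltW.
rewrite (enormZ _ (ltW gamma0)) exprMn.
have -> : x - u = - ((v - x) + (u - v)).
  by rewrite (addrC (v - x)) addrA subrK opprB.
have tri := enormD_sqr_le (v - x) (u - v); rewrite enormN.
have := ler_wpM2l (sqr_ge0 gamma) tri; lra.
Qed.

(** The optimality condition at x' is used t - 1 times against x and once against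
    xs.  The inner product of delta with xs - x' is split at x because the
    part along xs - x will have mean zero. *)
Lemma prox_step_progress x g xs t (x' := prox_step X x g gamma)
    (delta := g - gradf x) :
  X x -> X xs -> (1 <= t)%N ->
  t%:R * f x' - (t%:R - 1) * f x - f xs +
    gamma / 2 * (enorm (xs - x') ^+ 2 - enorm (xs - x) ^+ 2) <=
  (t%:R * (L / 2 - gamma) + gamma / 2) * enorm (x' - x) ^+ 2
  - t%:R * dotp delta (x' - x) +
  l / 2 * enorm (xs - x) ^+ 2 + dotp delta (xs - x).
Proof.
move=> Xx Xxs t1.
have Xx' : X x' by exact: prox_step_in.
have a := descent_lemma Xconvex fC1 fL Xx' Xx.
have b := prox_step_variational X0 Xconvex Xcompact x g (ltW gamma0) Xx.
have c := prox_step_variational X0 Xconvex Xcompact x g (ltW gamma0) Xxs.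
have d := fl Xxs Xx.
have t0 : 0 <= t%:R - 1 :> R by rewrite subr_ge0 ler1n.
rewrite -/x' in b c.
move: a b c d; rewrite /delta.
have -> : x - x' = - (x' - x) by rewrite opprB.
have -> : xs - x' = (xs - x) - (x' - x) by rewrite opprB addrA subrK.
move: (x' - x) (xs - x) => e w.
rewrite !enorm_sqr !dotpE (dotpC w e) => a b c d.
have := ler_wpM2l t0 a; have := mulr_ge0 t0 b; lra.
Qed.

Lemma young_step (delta e : 'rV[R]_n) :
  - dotp delta e <= gamma / 4 * enorm e ^+ 2 + enorm delta ^+ 2 / gamma.
Proof.
rewrite -(ler_pM2l gamma0) mulrDr (mulrCA gamma _ gamma^-1) mulfV ?gt_eqF// mulr1.
have := dotp_ge0 (delta + gamma / 2 *: e).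
rewrite !enorm_sqr !dotpE (dotpC e delta); lra.
Qed.

(** The term t gamma/4 |x' - x|^2 pays for the error through Young's inequality;
    what is left of the squared step length has coefficient 2 gamma^2 W(t) and
    pays for the projected gradient.  Hence the values of W(t) and of
    noise_weight. *)
Lemma late_step x g xs t (x' := prox_step X x g gamma) (delta := g - gradf x) :
  X x -> X xs -> (2 <= t)%N ->
  weight gamma L t * enorm (projected_gradient X x (gradf x) gamma) ^+ 2 +
  t%:R * f x' - (t%:R - 1) * f x - f xs +
    gamma / 2 * (enorm (xs - x') ^+ 2 - enorm (xs - x) ^+ 2) <=
  l / 2 * diameter X ^+ 2 + noise_weight t * enorm delta ^+ 2 +
  dotp delta (xs - x).
Proof.
move=> Xx Xxs t2.
have := prox_step_progress g Xx Xxs (ltnW t2).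
rewrite -/x' -/delta => P.
have Y := ler_wpM2l (ler0n R t) (young_step delta (x' - x)).
have H := ler_wpM2l (ltW (weight_gt0 t2)) (projected_gradient_bound x (gradf x) g).
have D : l / 2 * enorm (xs - x) ^+ 2 <= l / 2 * diameter X ^+ 2.
  rewrite ler_wpM2l ?divr_ge0// lerXn2r ?nnegrE ?enorm_ge0//.
    exact: le_trans (enorm_ge0 _) (enorm_le_diameter Xcompact Xxs Xx).
  exact: enorm_le_diameter.
have W : weight gamma L t * (2 * gamma ^+ 2 * enorm (x' - x) ^+ 2 +
    2 * enorm delta ^+ 2) =
  ((3 * t%:R - 2) * gamma / 4 - t%:R * L / 2) * enorm (x' - x) ^+ 2 +
  (noise_weight t - t%:R / gamma) * enorm delta ^+ 2.
  by rewrite /weight /noise_weight; field; rewrite gt_eqF.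
rewrite -/x' -/delta W in H.
have E : (noise_weight t - t%:R / gamma) * enorm delta ^+ 2 =
    noise_weight t * enorm delta ^+ 2 - t%:R * (enorm delta ^+ 2 / gamma) by ring.
move: P Y H D; rewrite E.
set A := enorm delta ^+ 2 / gamma; set B := noise_weight t * _.
set h := weight _ _ _ * _; lra.
Qed.

(** For t = 1 the coefficient of the squared step length left by Young's
    inequality is L/2 - gamma/4, which may be positive; since L < gamma it is at
    most L/4, and the squared step length is at most D^2. *)
Lemma first_step x g xs (x' := prox_step X x g gamma) (delta := g - gradf x) :
  X x -> X xs ->
  f x' - f xs + gamma / 2 * enorm (xs - x') ^+ 2 <=
  (gamma / 2 + L / 4 + l / 2) * diameter X ^+ 2 + enorm delta ^+ 2 / gamma +
  dotp delta (xs - x).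
Proof.
move=> Xx Xxs.
have := prox_step_progress g Xx Xxs (leqnn 1).
rewrite -/x' -/delta => P.
have Y := young_step delta (x' - x).
have D y z : X y -> X z -> enorm (y - z) ^+ 2 <= diameter X ^+ 2.
  move=> Xy Xz; have yz := enorm_le_diameter Xcompact Xy Xz.
  by rewrite lerXn2r ?nnegrE ?enorm_ge0 ?(le_trans _ yz) ?enorm_ge0.
have D1 : (L / 4) * enorm (x' - x) ^+ 2 <= L / 4 * diameter X ^+ 2.
  by rewrite ler_wpM2l ?divr_ge0//; apply: D => //; exact: prox_step_in.
have D2 : (gamma / 2 + l / 2) * enorm (xs - x) ^+ 2 <=
    (gamma / 2 + l / 2) * diameter X ^+ 2.
  by rewrite ler_wpM2l ?D// addr_ge0 ?divr_ge0// ltW.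
have D3 : 0 <= (gamma - L) / 4 * enorm (x' - x) ^+ 2.
  by rewrite mulr_ge0 ?sqr_ge0// divr_ge0// subr_ge0 ltW.
lra.
Qed.

(** The induction carries the nonnegative potential
    k (f (x k) - f xs) + gamma/2 |xs - x k|^2, dropped at the end. *)
Lemma pathwise_bound (x g : nat -> 'rV[R]_n) xs
    (delta := fun t => g t - gradf (x t.-1)) :
  (forall t, X (x t)) -> (forall t, x t.+1 = prox_step X (x t) (g t.+1) gamma) ->
  X xs -> (forall y, X y -> f xs <= f y) -> forall k, (1 <= k)%N ->
  \sum_(2 <= t < k.+1) weight gamma L t *
    enorm (projected_gradient X (x t.-1) (gradf (x t.-1)) gamma) ^+ 2 <=
  (gamma / 2 + L / 4 + l * k%:R / 2) * diameter X ^+ 2 +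
  \sum_(2 <= t < k.+1) noise_weight t * enorm (delta t) ^+ 2 +
  enorm (delta 1%N) ^+ 2 / gamma +
  \sum_(1 <= t < k.+1) dotp (delta t) (xs - x t.-1).
Proof.
move=> Xx xE Xxs fmin k k1.
pose h t := enorm (projected_gradient X (x t.-1) (gradf (x t.-1)) gamma) ^+ 2.
have step t : (2 <= t)%N -> weight gamma L t * h t +
    t%:R * f (x t) - (t%:R - 1) * f (x t.-1) - f xs +
    gamma / 2 * (enorm (xs - x t) ^+ 2 - enorm (xs - x t.-1) ^+ 2) <=
    l / 2 * diameter X ^+ 2 + noise_weight t * enorm (delta t) ^+ 2 +
    dotp (delta t) (xs - x t.-1).
  by case: t => // t t2; rewrite xE; exact: late_step.
suff S : \sum_(2 <= t < k.+1) weight gamma L t * h t +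
    k%:R * (f (x k) - f xs) + gamma / 2 * enorm (xs - x k) ^+ 2 <=
  (gamma / 2 + L / 4 + l * k%:R / 2) * diameter X ^+ 2 +
  \sum_(2 <= t < k.+1) noise_weight t * enorm (delta t) ^+ 2 +
  enorm (delta 1%N) ^+ 2 / gamma +
  \sum_(1 <= t < k.+1) dotp (delta t) (xs - x t.-1).
  apply: le_trans S; rewrite -addrA lerDl addr_ge0//.
    by rewrite mulr_ge0// subr_ge0 fmin.
  by rewrite mulr_ge0 ?sqr_ge0// divr_ge0// ltW.
elim: k k1 => // -[_ _|k IH _].
  rewrite (@big_geq _ _ _ 2) // (@big_geq _ _ _ 2) // big_nat1 /= xE.
  rewrite mul1r mulr1 add0r addr0.
  exact: first_step.
have recr m (F : nat -> R) : (m <= k.+2)%N ->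
    \sum_(m <= t < k.+3) F t = \sum_(m <= t < k.+2) F t + F k.+2.
  by move=> mk; rewrite big_nat_recr.
have := IH isT; have := step k.+2 isT; rewrite !recr//=.
set S1 := \sum_(_ <= _ < _) _; set S2 := \sum_(_ <= _ < _) _.
set S3 := \sum_(_ <= _ < _) _.
rewrite -[k.+2%:R]natr1; lra.
Qed.

End one_step.

(** * Measurable random vectors *)

Section vec_measurable.
Context {R : realType} {d : measure_display} {T : measurableType d}.

Definition vec_measurable n (Y : T -> 'rV[R]_n) : Prop :=
  measurable_fun [set: T] (Y : T -> borel_rV R n).

(** The open boxes used are balls of the sup norm with rational centre and radius
    1 / (m + 1); there are countably many of them, and membership in a box is a
    condition on coordinates. *)
Lemma open_rat_boxes n (U : set 'rV[R]_n) : open U ->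
  U = \bigcup_(p in [set p : 'rV[rat]_n * nat |
        forall v : 'rV[R]_n,
          (forall i, `|ratr (p.1 0 i) - v 0 i| < p.2.+1%:R^-1) -> U v])
      [set v : 'rV[R]_n | forall i, `|ratr (p.1 0 i) - v 0 i| < p.2.+1%:R^-1].
Proof.
move=> oU; apply/seteqP; split=> [v Uv|v [p /= pU pv]]; last exact: pU.
have /nbhs_ballP[e /= e0 eU] : nbhs v U by exact: open_nbhs_nbhs.
have [m me] : exists m, m.+1%:R^-1 < e / 2.
  have [m _ h] := near_infty_natSinv_lt (PosNum (divr_gt0 e0 (ltr0n R 2))).
  by exists m; exact: (h m (leqnn m)).
have m0 : 0 < m.+1%:R^-1 :> R by rewrite invr_gt0.
have [q hq] : exists q : 'I_n -> rat, forall i, `|ratr (q i) - v 0 i| < m.+1%:R^-1.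
  suff /choice[q hq] : forall i, exists q, `|ratr q - v 0 i| < m.+1%:R^-1.
    by exists q.
  move=> i.
  have [|q] := @rat_in_itvoo R (v 0 i - m.+1%:R^-1) (v 0 i + m.+1%:R^-1).
    by rewrite ltrD2l gtrN.
  rewrite in_itv/= => /andP[q1 q2]; exists q.
  by rewrite ltr_norml ltrBrDl q1 ltrBlDl.
exists (\row_i q i, m) => /=; last by move=> i; rewrite mxE.
move=> w hw; apply: eU; split => // j i; rewrite (ord1 j) /ball/=.
have := hw i; have := hq i; rewrite mxE => h1 h2.
rewrite -(subrKA (ratr (q i))) (le_lt_trans (ler_normD _ _))//.
by rewrite distrC [e]splitr; apply: lt_trans (ltrD h1 h2) _; rewrite ltrD.
Qed.

(** Coordinates are continuous, and the converse holds because open sets are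
    countable unions of boxes. *)
Lemma vec_measurableP n (Y : T -> 'rV[R]_n) :
  vec_measurable Y <-> forall i, measurable_fun [set: T] (fun w => Y w 0 i).
Proof.
split=> [mY i|mY].
  apply: (measurability _ (RGenOInfty.measurableE R)) => _ [_ [x ->] <-].
  rewrite setTI; pose U := [set u : 'rV[R]_n | x < u 0 i].
  have oU : open U.
    apply: (@open_comp _ _ (fun u : 'rV[R]_n => u 0 i) [set y | x < y]).
      by move=> u _; exact: coord_continuous.
    exact: open_gt.
  have mU : measurable (U : set (borel_rV R n)) by exact: sub_sigma_algebra.
  have := mY measurableT _ mU; rewrite setTI.
  by congr measurable; apply/seteqP; split=> w /=; rewrite in_itv/= andbT.
apply: (@measurability _ _ _ (borel_rV R n) _ _ (@open 'rV[R]_n)) => //.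
move=> _ [U oU <-]; rewrite setTI (open_rat_boxes oU) preimage_bigcup.
rewrite bigcup_mkcond.
apply: countable_bigcupT_measurable => [|p]; first exact: countableP.
case: ifPn => // _.
rewrite (_ : _ @^-1` _ = \bigcap_(i in [set: 'I_n])
    [set w | `|ratr (p.1 0 i) - Y w 0 i| < p.2.+1%:R^-1]); last first.
  by apply/seteqP; split=> w /= h i //=; exact: h.
apply: fin_bigcap_measurable => [|i _]; first exact: finite_finset.
have mN : measurable_fun [set: T] (fun w => `|ratr (p.1 0 i) - Y w 0 i|).
  by apply: measurableT_comp => //; exact: measurable_funB.
have := mN measurableT _ (measurable_itv `]-oo, p.2.+1%:R^-1[); rewrite setTI.
by congr measurable; apply/seteqP; split=> w /=; rewrite in_itv.
Qed.

Lemma vec_measurable_continuous m n (h : 'rV[R]_m -> 'rV[R]_n) (Y : T -> 'rV[R]_m) :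
  continuous h -> vec_measurable Y -> vec_measurable (h \o Y).
Proof.
move=> ch mY.
apply: (@measurability _ _ _ (borel_rV R n) _ _ (@open 'rV[R]_n)) => //.
move=> _ [U oU <-].
have oV : open (h @^-1` U) by apply: open_comp => // v _; exact: ch.
have mV : measurable (h @^-1` U : set (borel_rV R m)) by exact: sub_sigma_algebra.
by have := mY measurableT _ mV.
Qed.

Lemma vec_measurable_cst n (v : 'rV[R]_n) : vec_measurable (fun=> v).
Proof. exact: measurable_cst. Qed.

Lemma vec_measurableD n (Y Z : T -> 'rV[R]_n) :
  vec_measurable Y -> vec_measurable Z -> vec_measurable (fun w => Y w + Z w).
Proof.
move=> /vec_measurableP mY /vec_measurableP mZ; apply/vec_measurableP => i.
by under eq_fun do rewrite mxE; exact: measurable_funD.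
Qed.

Lemma vec_measurableZ n (a : R) (Y : T -> 'rV[R]_n) :
  vec_measurable Y -> vec_measurable (fun w => a *: Y w).
Proof.
move=> /vec_measurableP mY; apply/vec_measurableP => i.
by under eq_fun do rewrite mxE; exact: measurable_funM.
Qed.

Lemma vec_measurableB n (Y Z : T -> 'rV[R]_n) :
  vec_measurable Y -> vec_measurable Z -> vec_measurable (fun w => Y w - Z w).
Proof.
move=> mY mZ; under eq_fun do rewrite -scaleN1r.
by apply: vec_measurableD => //; exact: vec_measurableZ.
Qed.

Lemma vec_measurable_sum n (I : eqType) (r : seq I) (Y : I -> T -> 'rV[R]_n) :
  (forall i, i \in r -> vec_measurable (Y i)) ->
  vec_measurable (fun w => \sum_(i <- r) Y i w).
Proof.
elim: r => [|i r IH] mY.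
  by under eq_fun do rewrite big_nil; exact: vec_measurable_cst.
under eq_fun do rewrite big_cons.
apply: vec_measurableD; first by apply: mY; rewrite mem_head.
by apply: IH => j jr; apply: mY; rewrite inE jr orbT.
Qed.

Lemma measurable_dotp n (Y Z : T -> 'rV[R]_n) :
  vec_measurable Y -> vec_measurable Z ->
  measurable_fun [set: T] (fun w => dotp (Y w) (Z w)).
Proof.
move=> /vec_measurableP mY /vec_measurableP mZ.
by apply: measurable_sum => i; exact: measurable_funM.
Qed.

Lemma measurable_enorm_sqr n (Y : T -> 'rV[R]_n) :
  vec_measurable Y -> measurable_fun [set: T] (fun w => enorm (Y w) ^+ 2).
Proof.
by move=> mY; under eq_fun do rewrite enorm_sqr; exact: measurable_dotp.
Qed.

End vec_measurable.

(** * Means, independence and freezing *)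

Section mean_le.
Context {R : realType} {d : measure_display} {T : measurableType d}.
Variable P : probability T R.
Implicit Types (X Y : T -> R) (a c : R).

(** Integrability is bundled with the bound so that the bounds below add up
    without finiteness side conditions. *)
Definition mean_le X c : Prop :=
  P.-integrable [set: T] (EFin \o X) /\ (\int[P]_w (X w)%:E <= c%:E)%E.

Lemma mean_le_measurable X c : mean_le X c -> measurable_fun [set: T] X.
Proof. by case=> /integrableP[/measurable_EFinP]. Qed.

Lemma mean_leW X a c : a <= c -> mean_le X a -> mean_le X c.
Proof. by move=> ac [iX Xa]; split=> //; rewrite (le_trans Xa)// lee_fin. Qed.

Lemma mean_le_cst c : mean_le (fun=> c) c.
Proof.
split; first exact: finite_measure_integrable_cst.
by rewrite integral_cst//= probability_setT mule1.
Qed.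

Lemma mean_leD X Y a c : mean_le X a -> mean_le Y c ->
  mean_le (fun w => X w + Y w) (a + c).
Proof.
move=> [iX Xa] [iY Yc]; split; first exact: (integrableD measurableT iX iY).
by under eq_integral do rewrite EFinD; rewrite integralD// EFinD leeD.
Qed.

Lemma mean_leZ X a c : 0 <= a -> mean_le X c ->
  mean_le (fun w => a * X w) (a * c).
Proof.
move=> a0 [iX Xc]; split; first exact: (integrableZl measurableT a iX).
under eq_integral do rewrite EFinM.
by rewrite integralZl// EFinM lee_wpmul2l// lee_fin.
Qed.

Lemma mean_le_sum (I : eqType) (r : seq I) (X : I -> T -> R) (c : I -> R) :
  (forall i, i \in r -> mean_le (X i) (c i)) ->
  mean_le (fun w => \sum_(i <- r) X i w) (\sum_(i <- r) c i).
Proof.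
elim: r => [|i r IH] h.
  rewrite big_nil; under eq_fun do rewrite big_nil; exact: mean_le_cst.
rewrite big_cons; under eq_fun do rewrite big_cons.
apply: mean_leD; first by apply: h; rewrite mem_head.
by apply: IH => j jr; apply: h; rewrite inE jr orbT.
Qed.

Lemma mean_le_nonneg X c : measurable_fun [set: T] X -> (forall w, 0 <= X w) ->
  (\int[P]_w (X w)%:E <= c%:E)%E -> mean_le X c.
Proof.
move=> mX X0 Xc; split=> //; apply/integrableP; split.
  exact/measurable_EFinP.
under eq_integral do rewrite gee0_abs ?lee_fin//.
exact: le_lt_trans Xc (ltry _).
Qed.

Lemma expectation_le_mean X Y c : measurable_fun [set: T] X ->
  (forall w, 0 <= X w) -> (forall w, X w <= Y w) -> mean_le Y c ->
  ('E_P[X] <= c%:E)%E.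
Proof.
move=> mX X0 XY mY; rewrite unlock; apply: le_trans mY.2.
apply: ge0_le_integral => //.
- by move=> w _; rewrite lee_fin.
- exact/measurable_EFinP.
- by apply/measurable_EFinP; exact: mean_le_measurable mY.
- by move=> w _; rewrite lee_fin.
Qed.

End mean_le.

Section freezing.
Local Open Scope ereal_scope.
Context {R : realType} {d d1 d2 : measure_display} {T : measurableType d}
  {A : measurableType d1} {Xi : measurableType d2}.
Variables (P : probability T R) (mu : probability Xi R).
Variables (U : T -> A) (V : T -> Xi).
Hypotheses (mU : measurable_fun [set: T] U) (mV : measurable_fun [set: T] V).
Hypothesis UV : forall E B, measurable E -> measurable B ->
  P (U @^-1` E `&` V @^-1` B) = P (U @^-1` E) * mu B.

Let Um : {mfun T >-> A} := HB.pack U (isMeasurableFun.Build _ _ _ _ U mU).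
Let UVm : {mfun T >-> (A * Xi)%type} := HB.pack (fun w => (U w, V w))
  (isMeasurableFun.Build _ _ _ _ _ (measurable_fun_pair mU mV)).

Let law_UV Z : measurable Z -> (distribution P Um \x mu) Z = distribution P UVm Z.
Proof. by apply: product_measure_unique => E B mE mB; exact: UV. Qed.

(** Independence makes the law of (U, V) the product of the laws of U and V, so
    this is Tonelli's theorem. *)
Lemma freeze_ge0 (h : (A * Xi)%type -> \bar R) :
  measurable_fun [set: (A * Xi)%type] h -> (forall p, 0 <= h p) ->
  \int[P]_w h (U w, V w) = \int[P]_w \int[mu]_z h (U w, z).
Proof.
move=> mh h0.
rewrite -[LHS](@ge0_integral_distribution _ _ _ _ _ P UVm h mh h0).
rewrite -[RHS](@ge0_integral_distribution _ _ _ _ _ P Um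
  (fun a => \int[mu]_z h (a, z))); first last.
- by move=> a; exact: integral_ge0.
- exact: measurable_fun_fubini_tonelli_F.
rewrite -[RHS](fubini_tonelli1 h)//.
by apply: eq_measure_integral => Z mZ _; exact/esym/law_UV.
Qed.

(** Fubini's theorem for the same law.  For the oracle, the inner integral
    vanishes by unbiasedness. *)
Lemma freeze_eq0 (h : (A * Xi)%type -> \bar R) :
  measurable_fun [set: (A * Xi)%type] h ->
  P.-integrable [set: T] (fun w => h (U w, V w)) ->
  (forall a, \int[mu]_z h (a, z) = 0) ->
  \int[P]_w h (U w, V w) = 0.
Proof.
move=> mh ih h0.
rewrite -[LHS](@integral_distribution _ _ _ _ _ P UVm h mh ih).
transitivity (\int[distribution P Um \x mu]_z h z).
  by apply: eq_measure_integral => Z mZ _; exact/esym/law_UV.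
rewrite -integral12_prod_meas1; first by rewrite /fubini_F integral0_eq.
have ih' : (distribution P UVm).-integrable setT h.
  exact: (@integrable_pushforward _ _ _ _ _ _ (measurable_fun_pair mU mV) P).
apply/integrableP; split => //; move/integrableP : ih' => [_].
congr (_ < _); apply: eq_measure_integral => Z mZ _; exact/esym/law_UV.
Qed.

End freezing.

Section independence.
Local Open Scope ereal_scope.
Context {R : realType} {d d' : measure_display} {T : measurableType d}
  {Xi : measurableType d'} {I : choiceType}.
Variables (P : probability T R) (mu : probability Xi R) (J : set I)
  (xi : I -> T -> Xi).
Hypothesis xi_iid : iid P mu J xi.

(** Finite-dimensional cylinders, written with a full family A that is trivial
    outside the finite support s: intersections are then taken index by index. *)
Let cylinder (K : set I) : set (set T) := [set E | exists (s : seq I) (A : I -> set Xi),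
  [/\ uniq s, forall j, measurable (A j), forall j, j \in s -> K j,
      forall j, j \notin s -> A j = setT & E = [set w | forall j, A j (xi j w)]]].

Lemma generated_sigma_algebra_measurable (K : set I) : K `<=` J ->
  generated_sigma_algebra K xi `<=` measurable.
Proof.
move=> KJ; apply: smallest_sub; first exact: sigma_algebra_measurable.
move=> _ [i Ki [B mB <-]]; apply: (iid_measurable xi_iid) => //; exact: KJ.
Qed.

Let cylinderE (s : seq I) (A : I -> set Xi) : (forall j, j \notin s -> A j = setT) ->
  [set w | forall j, A j (xi j w)] = \big[setI/setT]_(j <- s) (xi j @^-1` A j).
Proof.
move=> As; rewrite -(bigcap_seq s (fun j => xi j @^-1` A j)).
apply/seteqP; split=> w /= h j; first by move=> _; exact: h.
by have [js|js] := boolP (j \in s); [exact: h|rewrite As].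
Qed.

Let cylinder_measurable K : K `<=` J -> cylinder K `<=` measurable.
Proof.
move=> KJ _ [s [A [us mA sK As ->]]]; rewrite (cylinderE As).
rewrite -(bigcap_seq s (fun j => xi j @^-1` A j)).
apply: fin_bigcap_measurable => [|j /= js]; first exact: finite_seq.
rewrite -[X in measurable X]setTI.
by apply: (iid_measurable xi_iid (KJ _ (sK _ js))).
Qed.

Let cylinderI K : setI_closed (cylinder K).
Proof.
move=> _ _ [s [A [us mA sK As ->]]] [s' [A' [us' mA' sK' As' ->]]].
exists (undup (s ++ s')), (fun j => A j `&` A' j); split.
- exact: undup_uniq.
- by move=> j; exact: measurableI.
- by move=> j; rewrite mem_undup mem_cat => /orP[/sK|/sK'].
- move=> j; rewrite mem_undup mem_cat negb_or => /andP[js js'].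
  by rewrite As// As'// setIT.
- by apply/seteqP; split=> w /= => [[h h'] j|h]; [split|split=> j; case: (h j)].
Qed.

(** The two finite measures P (E /\ xi_i in B) and P E * mu B agree on the
    cylinders over K, by the product rule for the family i :: s, and cylinders
    form a pi-system that generates the sigma-algebra. *)
Lemma history_indep (K : set I) i E B : K `<=` J -> J i -> ~ K i ->
  generated_sigma_algebra K xi E -> measurable B ->
  P (E `&` xi i @^-1` B) = P E * mu B.
Proof.
move=> KJ Ji Ki gE mB.
have mxB : measurable (xi i @^-1` B).
  by rewrite -[X in measurable X]setTI; exact: (iid_measurable xi_iid).
have muB : (fine (mu B) >= 0)%R by exact: fine_ge0.
have muBE : (fine (mu B))%:E = mu B by rewrite fineK// fin_num_measure.
suff : mrestr P mxB E = mscale (NngNum muB) P E.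
  by rewrite /mrestr /mscale /= muBE muleC.
have gC : generated_sigma_algebra K xi `<=` <<s cylinder K >>.
  apply: sub_sigma_algebra2 => _ [j Kj [A mA <-]].
  exists [:: j], (fun k => if k == j then A else setT); split => //.
  - by move=> k; case: ifP.
  - by move=> k; rewrite inE => /eqP ->.
  - by move=> k; rewrite inE => /negbTE ->.
  - rewrite setTI; apply/seteqP; split=> w /= => [h k|/(_ j)]; last by rewrite eqxx.
    by case: eqP => [->|].
apply: (@g_sigma_algebra_measure_unique _ _ _ (cylinder K) _ (fun=> setT)
  _ _ _ _ _ _ _ E (gC _ gE)).
- exact: cylinder_measurable.
- move=> _; exists [::], (fun=> setT); split => //.
  by apply/seteqP; split.
- by rewrite bigcup_const.
- exact: cylinderI.
- move=> _ [s [A [us mA sK As ->]]].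
  transitivity (mu B * P [set w | forall j, A j (xi j w)]); last first.
    by rewrite -[RHS]/((fine (mu B))%:E * _) muBE.
  rewrite -[LHS]/(P ([set w | forall j, A j (xi j w)] `&` xi i @^-1` B)).
  have is' : i \notin s by apply/negP => /sK.
  have PE : P [set w | forall j, A j (xi j w)] = \prod_(j <- s) P (xi j @^-1` A j).
    rewrite (cylinderE As); apply: (iid_indep xi_iid) => // j js.
    by split; [exact/KJ/sK|].
  rewrite PE -(iid_law xi_iid Ji mB).
  pose A' j := if j == i then B else A j.
  have := @iid_indep _ _ _ _ _ _ _ _ _ _ xi_iid (i :: s) A'.
  rewrite /= is' us !big_cons => /(_ isT) H.
  rewrite setIC (cylinderE As).
  have A'i : A' i = B by rewrite /A' eqxx.
  have A's j : j \in s -> A' j = A j.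
    by move=> js; rewrite /A'; case: eqP => // ji; rewrite -ji js in is'.
  rewrite A'i in H; rewrite -(eq_big_seq _ (fun j js => congr1 _ (A's j js))).
  rewrite [in RHS](eq_big_seq (fun j => P (xi j @^-1` A' j))); last first.
    by move=> j js; rewrite A's.
  apply: H => j; rewrite inE => /predU1P[->|js]; first by rewrite A'i.
  by rewrite A's//; split => //; exact/KJ/sK.
- move=> _; rewrite /= /mrestr (le_lt_trans _ (ltry 1))//.
  by apply: probability_le1; exact: measurableI.
Qed.

End independence.

(** * Measurability of the iterates *)

Section process_measurability.
Context {R : realType} {n : nat}.
Variables (X : set 'rV[R]_n) (gradf : 'rV[R]_n -> 'rV[R]_n) (L gamma : R).
Hypotheses (X0 : X !=set0) (Xconvex : convex_set (M := 'rV[R]_n) X)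
  (Xcompact : compact X) (fL : lipschitz_gradient X gradf L).
Hypotheses (L0 : 0 <= L) (gamma0 : 0 < gamma).
Context {dXi : measure_display} {Xi : measurableType dXi} (mu : probability Xi R)
  (G : 'rV[R]_n -> Xi -> 'rV[R]_n) (sigma : R).
Hypothesis G_oracle : stochastic_oracle X gradf mu G sigma.

(** T is arbitrary since the same facts are needed on Omega, on Omega with a
    smaller sigma-algebra, and on products with the sample space. *)
Section on_any_sigma_algebra.
Context {d : measure_display} {T : measurableType d}.

Lemma measurable_projection (Y : T -> 'rV[R]_n) (c : R) : 0 < c ->
  vec_measurable Y -> vec_measurable (fun w => prox_step X (Y w) 0 c).
Proof.
move=> c0; apply: (vec_measurable_continuous (h := fun y => prox_step X y 0 c)).
apply: (@lipschitz_continuous _ _ _ _ 1) => u v; rewrite mul1r.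
apply: le_trans (prox_step_lipschitz X0 Xconvex Xcompact _ _ _ _ c0) _.
by rewrite scaler0 !subr0.
Qed.

Lemma measurable_prox (Y g : T -> 'rV[R]_n) :
  vec_measurable Y -> vec_measurable g ->
  vec_measurable (fun w => prox_step X (Y w) (g w) gamma).
Proof.
move=> mY mg; under eq_fun do rewrite prox_step_projection//.
apply: measurable_projection => //.
by apply: vec_measurableB => //; exact: vec_measurableZ.
Qed.

(** gradf is controlled on X only; precomposed with the projection on X it is
    Lipschitz on the whole space, hence continuous. *)
Lemma measurable_gradient (Y : T -> 'rV[R]_n) : (forall w, X (Y w)) ->
  vec_measurable Y -> vec_measurable (fun w => gradf (Y w)).
Proof.
move=> XY mY.
(* Y takes its values in X, where the projection is the identity. *)
rewrite (_ : (fun w => _) = fun w => gradf (prox_step X (Y w) 0 1)); last first.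
  by apply/funext => w; rewrite prox_step_id.
move: mY; apply: (vec_measurable_continuous (h := fun y => gradf (prox_step X y 0 1))).
apply: (@lipschitz_continuous _ _ _ _ L) => u v.
apply: le_trans (fL (prox_step_in _ _ _ _ _) (prox_step_in _ _ _ _ _)) _ => //.
rewrite ler_wpM2l//.
apply: le_trans (prox_step_lipschitz X0 Xconvex Xcompact _ _ _ _ ltr01) _.
by rewrite scaler0 !subr0.
Qed.

Lemma measurable_oracle (Y : T -> 'rV[R]_n) (v : T -> Xi) :
  (forall w, X (Y w)) -> vec_measurable Y -> measurable_fun [set: T] v ->
  vec_measurable (fun w => G (Y w) (v w)).
Proof.
move=> XY mY mv.
have mX : measurable (X : set (borel_rV R n)).
  rewrite -[X]setCK; apply: measurableC; apply: sub_sigma_algebra => /=.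
  by apply: closed_openC; apply: compact_closed => //; exact: norm_hausdorff.
apply: (measurable_comp _ _ (oracle_measurable G_oracle)
  (measurable_fun_pair (mY : measurable_fun _ (Y : T -> borel_rV R n)) mv)).
  exact: measurableX.
by move=> _ [w _ <-]; split => //=; exact: XY.
Qed.

Variables (b : nat -> nat) (xi : nat * nat -> T -> Xi) (x0 : 'rV[R]_n).
Hypothesis x0X : X x0.
Let x := spg X G (fun=> gamma) b xi x0.

Lemma spg_in t w : X (x t w).
Proof. by case: t => [|t] //; exact: prox_step_in. Qed.

Lemma spg_measurable t :
  (forall i, sample_index b i -> (i.1 <= t)%N -> measurable_fun [set: T] (xi i)) ->
  vec_measurable (x t).
Proof.
elim: t => [|t IH] mxi; first exact: vec_measurable_cst.
have mx : vec_measurable (x t).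
  by apply: IH => i Ji it; apply: mxi => //; exact: leqW.
apply: measurable_prox => //; apply: vec_measurableZ.
apply: vec_measurable_sum => j; rewrite mem_index_iota => j1.
apply: measurable_oracle => //; first exact: spg_in.
exact: mxi.
Qed.

End on_any_sigma_algebra.

End process_measurability.

(** * The error of the mini-batch oracle *)

Section oracle_error.
Context {R : realType} {n : nat}.
Variables (X : set 'rV[R]_n) (gradf : 'rV[R]_n -> 'rV[R]_n).
Context {dXi : measure_display} {Xi : measurableType dXi} (mu : probability Xi R)
  (G : 'rV[R]_n -> Xi -> 'rV[R]_n) (sigma : R).
Hypothesis G_oracle : stochastic_oracle X gradf mu G sigma.

Lemma oracle_error_mean0 x y : X x ->
  (\int[mu]_z (dotp (G x z - gradf x) y)%:E = 0)%E.
Proof.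
move=> Xx; rewrite /dotp.
have iG i : mu.-integrable [set: Xi] (fun z => (G x z 0 i)%:E - (gradf x 0 i)%:E)%E.
  apply: integrableB => //; first exact: (oracle_unbiased G_oracle Xx i).1.
  exact: finite_measure_integrable_cst.
under eq_integral => z _.
  rewrite -sumEFin; under eq_bigr do rewrite !mxE mulrC EFinM EFinB.
  over.
rewrite integral_sum//; last by move=> i; exact: integrableZl.
rewrite big1// => i _; rewrite integralZl//.
rewrite integralB//; last 2 first.
- exact: (oracle_unbiased G_oracle Xx i).1.
- exact: finite_measure_integrable_cst.
rewrite integral_cst//= probability_setT mule1.
have := (oracle_unbiased G_oracle Xx i).2; rewrite unlock => ->.
by rewrite subee// mule0.
Qed.

End oracle_error.

Section noise.
Context {R : realType} {n : nat}.
Variables (X : set 'rV[R]_n) (gradf : 'rV[R]_n -> 'rV[R]_n) (L gamma : R).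
Hypotheses (X0 : X !=set0) (Xconvex : convex_set (M := 'rV[R]_n) X)
  (Xcompact : compact X) (fL : lipschitz_gradient X gradf L).
Hypotheses (L0 : 0 <= L) (gamma0 : 0 < gamma).
Context {dXi : measure_display} {Xi : measurableType dXi} (mu : probability Xi R)
  (G : 'rV[R]_n -> Xi -> 'rV[R]_n) (sigma : R).
Hypothesis G_oracle : stochastic_oracle X gradf mu G sigma.
Context {dO : measure_display} {Omega : measurableType dO} (P : probability Omega R).
Variables (b : nat -> nat) (xi : nat * nat -> Omega -> Xi) (x0 : 'rV[R]_n).
Hypotheses (b_gt0 : forall t, (1 <= t)%N -> (0 < b t)%N) (x0X : X x0).
Hypothesis xi_iid : iid P mu (sample_index b) xi.

Let J := sample_index b.
Let x := spg X G (fun=> gamma) b xi x0.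
Let xX t w : X (x t w). Proof. exact: (spg_in _ X0 Xcompact). Qed.

(** Same points as Omega, but only the information carried by the samples of
    index in K. *)
Definition history (K : set (nat * nat)) :=
  g_sigma_algebraType (\bigcup_(i in K) preimage_set_system setT (xi i) measurable).

Lemma history_sample K i : K i -> measurable_fun [set: history K] (xi i : history K -> Xi).
Proof.
move=> Ki _ A mA; apply: sub_sigma_algebra.
by exists i => //; exists A.
Qed.

Lemma history_iterate K t : (forall i, J i -> (i.1 <= t)%N -> K i) ->
  vec_measurable (x t : history K -> _).
Proof.
move=> tK; apply: (@spg_measurable _ _ _ _ _ X0 Xconvex Xcompact gamma0 _ _ _ _ _
  G_oracle _ (history K) b xi x0 x0X t) => i Ji it.
by apply: history_sample; exact: tK.
Qed.

Lemma history_measurable_id K : K `<=` J ->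
  measurable_fun [set: Omega] (id : Omega -> history K).
Proof.
move=> KJ _ A mA; rewrite setTI.
exact: (generated_sigma_algebra_measurable xi_iid KJ).
Qed.

Lemma vec_measurable_history K (Y : Omega -> 'rV[R]_n) : K `<=` J ->
  vec_measurable (Y : history K -> _) -> vec_measurable Y.
Proof.
move=> KJ mY; apply: (@measurableT_comp _ _ _ _ (history K) _ _ _ _ mY).
exact: history_measurable_id.
Qed.

Definition oracle_error (i : nat * nat) (w : Omega) : 'rV[R]_n :=
  G (x i.1.-1 w) (xi i w) - gradf (x i.1.-1 w).

Section one_sample.
Variable i : nat * nat.
Hypothesis Ji : J i.
(* The history consists of all the other samples, later ones included: this
   keeps independence and lets a sample of the same batch serve as Y. *)
Let K := [set k | J k /\ k <> i].

Let KJ : K `<=` J. Proof. by move=> k []. Qed.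

Let earlier k : J k -> (k.1 <= i.1.-1)%N -> K k.
Proof.
move=> Jk ki; split=> // ei; move: ki; rewrite ei.
by case: Ji; case: (i.1) => // m _ _; rewrite ltnn.
Qed.

Let mxH : vec_measurable (x i.1.-1 : history K -> _).
Proof. exact: history_iterate. Qed.

Let mV : measurable_fun [set: Omega] (xi i).
Proof. exact: (iid_measurable xi_iid). Qed.

Let indep E B : measurable (E : set (history K)) -> measurable B ->
  (P ((id : Omega -> history K) @^-1` E `&` xi i @^-1` B) =
   P ((id : Omega -> history K) @^-1` E) * mu B)%E.
Proof. by move=> mE mB; apply: (history_indep xi_iid KJ Ji) => // -[]. Qed.

Let err (p : history K * Xi) := G (x i.1.-1 p.1) p.2 - gradf (x i.1.-1 p.1).

Let merr : vec_measurable err.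
Proof.
have mx1 : vec_measurable (fun p : history K * Xi => x i.1.-1 p.1).
  exact: (measurableT_comp mxH measurable_fst).
apply: vec_measurableB; last exact: (measurable_gradient X0 Xconvex Xcompact fL).
exact: (measurable_oracle Xcompact G_oracle).
Qed.

(** Given the other samples, x_{t-1} is a fixed point of X, where the variance
    bound of the oracle holds. *)
Lemma oracle_error_variance :
  mean_le P (fun w => enorm (oracle_error i w) ^+ 2) (sigma ^+ 2).
Proof.
have mU := history_measurable_id KJ.
have mh : measurable_fun setT (fun p => (enorm (err p) ^+ 2)%:E).
  by apply/measurable_EFinP; exact: measurable_enorm_sqr.
apply: mean_le_nonneg => [|w|]; last 1 first.
- have h0 p : (0 <= (enorm (err p) ^+ 2)%:E)%E by rewrite lee_fin sqr_ge0.
  rewrite [leLHS](freeze_ge0 mU mV indep mh h0).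
  have <- : (\int[P]_w (sigma ^+ 2)%:E = (sigma ^+ 2)%:E)%E.
    by rewrite integral_cst//= probability_setT mule1.
  apply: ge0_le_integral => //.
  + by move=> w _; exact: integral_ge0.
  + have mF := @measurable_fun_fubini_tonelli_F _ _ (history K) Xi R mu _ mh h0.
    exact: (measurableT_comp mF mU).
  + move=> w _; have := oracle_variance G_oracle (xX i.1.-1 w).
    by rewrite unlock.
- exact: (measurableT_comp (measurable_enorm_sqr merr) (measurable_fun_pair mU mV)).
- exact: sqr_ge0.
Qed.

(** Given the other samples, Y is a fixed vector and the oracle error has mean
    zero.  The second moment of Y only serves to make the product integrable. *)
Lemma oracle_error_orthogonal (Y : Omega -> 'rV[R]_n) (c : R) :
  vec_measurable (Y : history K -> _) ->
  mean_le P (fun w => enorm (Y w) ^+ 2) c ->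
  mean_le P (fun w => dotp (oracle_error i w) (Y w)) 0.
Proof.
move=> mY Yc; have mU := history_measurable_id KJ.
have mh : measurable_fun setT (fun p : history K * Xi => (dotp (err p) (Y p.1))%:E).
  apply/measurable_EFinP; apply: measurable_dotp => //.
  exact: (measurableT_comp mY measurable_fst).
have ih : P.-integrable setT (fun w => (dotp (oracle_error i w) (Y w))%:E).
  have [iS _] := mean_leD oracle_error_variance Yc.
  apply: le_integrable iS => //.
    exact: (measurableT_comp mh (measurable_fun_pair mU mV)).
  move=> w _; rewrite /= lee_fin.
  rewrite [leRHS]ger0_norm; last by rewrite addr_ge0// sqr_ge0.
  apply: le_trans (norm_dotp_le _ _) _.
  set p := enorm _; set q := enorm _; have := sqr_ge0 (p - q).
  have := sqr_ge0 p; have := sqr_ge0 q; nra.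
split=> //.
rewrite (_ : (\int[P]_w _ = 0)%E)//.
apply: (freeze_eq0 mU mV indep mh ih) => w.
exact: (oracle_error_mean0 G_oracle (Y w) (xX _ w)).
Qed.

End one_sample.

Lemma oracle_error_history K i : K i -> (forall k, J k -> (k.1 <= i.1.-1)%N -> K k) ->
  vec_measurable (oracle_error i : history K -> _).
Proof.
move=> Ki Kx; have mx := history_iterate Kx.
apply: vec_measurableB; last first.
  by apply: (measurable_gradient X0 Xconvex Xcompact fL L0 _ mx) => w; exact: xX.
apply: (measurable_oracle Xcompact G_oracle _ mx) => [w|]; first exact: xX.
exact: history_sample.
Qed.

Definition minibatch_error (t : nat) (w : Omega) : 'rV[R]_n :=
  minibatch G b xi t (x t.-1 w) w - gradf (x t.-1 w).

Let minibatch_errorE t w : (1 <= t)%N ->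
  minibatch_error t w = (b t)%:R^-1 *: \sum_(1 <= j < (b t).+1) oracle_error (t, j) w.
Proof.
move=> t1; rewrite /minibatch_error /minibatch /oracle_error sumrB scalerBr.
congr (_ - _); rewrite /= sumr_const_nat subn1 /=.
rewrite -[X in _ = _ *: X]scaler_nat scalerA mulVf ?scale1r//.
by rewrite pnatr_eq0 -lt0n b_gt0.
Qed.

Let sampleJ t j : (1 <= t)%N -> j \in index_iota 1 (b t).+1 -> J (t, j).
Proof. by move=> t1; rewrite mem_index_iota => j1; split. Qed.

(** Expand the square of the sum of the errors: distinct samples contribute
    nothing, and the diagonal b_t sigma^2. *)
Lemma minibatch_error_variance t : (1 <= t)%N ->
  mean_le P (fun w => enorm (minibatch_error t w) ^+ 2) (sigma ^+ 2 / (b t)%:R).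
Proof.
move=> t1; have bt0 : (b t)%:R != 0 :> R by rewrite pnatr_eq0 -lt0n b_gt0.
set r := index_iota 1 (b t).+1.
have cross j j' : j \in r -> j' \in r ->
    mean_le P (fun w => dotp (oracle_error (t, j) w) (oracle_error (t, j') w))
      (if j == j' then sigma ^+ 2 else 0).
  move=> jr j'r; have Jj := sampleJ t1 jr; have Jj' := sampleJ t1 j'r.
  have [<-|jj'] := eqVneq j j'.
    under eq_fun do rewrite -enorm_sqr; exact: oracle_error_variance.
  apply: (oracle_error_orthogonal Jj _ (oracle_error_variance Jj')).
  apply: oracle_error_history => [|k Jk kt].
    by split=> // -[ejj]; rewrite ejj eqxx in jj'.
  split=> // ek; move: kt; rewrite ek /=; case: (t) t1 => // m _.
  by rewrite ltnn.
have := mean_leZ (sqr_ge0 (b t)%:R^-1)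
  (mean_le_sum (fun j jr => mean_le_sum (fun j' j'r => cross j j' jr j'r))).
congr mean_le.
  apply/funext => w; rewrite minibatch_errorE// enormZ ?invr_ge0// exprMn.
  rewrite enorm_sqr dotp_suml; congr (_ * _); apply: eq_bigr => j _.
  by rewrite dotpC dotp_suml; apply: eq_bigr => j' _; rewrite dotpC.
rewrite (@eq_big_seq _ _ _ _ _ _ (fun=> sigma ^+ 2)).
  rewrite /r sumr_const_nat subn1 /= -mulr_natr exprVn; field.
  by rewrite bt0.
move=> j jr; rewrite (bigD1_seq j) ?iota_uniq//= eqxx big1 ?addr0// => j'.
by rewrite eq_sym => /negbTE ->.
Qed.

(** x_{t-1} depends on samples of earlier iterations only, and xs - x_{t-1} is
    bounded by the diameter. *)
Lemma minibatch_error_mean0 t xs : (1 <= t)%N -> X xs ->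
  mean_le P (fun w => dotp (minibatch_error t w) (xs - x t.-1 w)) 0.
Proof.
move=> t1 Xxs.
have one j : j \in index_iota 1 (b t).+1 ->
    mean_le P (fun w => dotp (oracle_error (t, j) w) (xs - x t.-1 w)) 0.
  move=> jr; have Jj := sampleJ t1 jr.
  have mY : vec_measurable (fun w : history [set k | J k /\ k <> (t, j)] =>
      xs - x t.-1 w).
    apply: vec_measurableB; first exact: vec_measurable_cst.
    apply: history_iterate => k Jk kt; split=> // ek.
    by move: kt; rewrite ek /=; case: (t) t1 => // m _; rewrite ltnn.
  apply: (oracle_error_orthogonal Jj mY (c := diameter X ^+ 2)).
  apply: mean_le_nonneg => [|w|]; last 1 first.
  - apply: (@le_trans _ _ (\int[P]_w (diameter X ^+ 2)%:E)%E).
      apply: ge0_le_integral => //.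
      + by move=> w _; rewrite lee_fin sqr_ge0.
      + apply/measurable_EFinP/measurable_enorm_sqr.
        by apply: (vec_measurable_history _ mY) => k [].
      + move=> w _; rewrite lee_fin.
        have xsx := enorm_le_diameter Xcompact Xxs (xX t.-1 w).
        by rewrite lerXn2r// nnegrE ?enorm_ge0// (le_trans _ xsx)// enorm_ge0.
    by rewrite integral_cst//= probability_setT mule1.
  - apply: measurable_enorm_sqr.
    by apply: (vec_measurable_history _ mY) => k [].
  - exact: sqr_ge0.
have b0 : 0 <= (b t)%:R^-1 :> R by rewrite invr_ge0.
have := mean_leZ b0 (mean_le_sum one); rewrite big1// mulr0.
congr mean_le; apply/funext => w.
by rewrite minibatch_errorE// dotpZl dotp_suml.
Qed.

End noise.

(** * The random output *)

(** The nonnegativity of the terms is asked for along r only: the weights W(t)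
    may be negative for t < 2. *)
Lemma ge0_integral_sum_seq {R : realType} {d : measure_display}
    {T : measurableType d} (P : probability T R) (I : eqType) (r : seq I)
    (F : I -> T -> \bar R) :
  (forall i, i \in r -> measurable_fun [set: T] (F i)) ->
  (forall i w, i \in r -> (0 <= F i w)%E) ->
  (\int[P]_w \sum_(i <- r) F i w = \sum_(i <- r) \int[P]_w F i w)%E.
Proof.
move=> mF F0; pose F' i := if i \in r then F i else cst 0%E.
have FF' i : i \in r -> F i = F' i by rewrite /F' => ->.
transitivity (\int[P]_w \sum_(i <- r) F' i w)%E.
  by apply: eq_integral => w _; apply: eq_big_seq => i ir; rewrite FF'.
rewrite ge0_integral_sum//; last 2 first.
- by move=> i; rewrite /F'; case: ifPn => // ir; exact: mF.
- by move=> i w _; rewrite /F'; case: ifPn => // ir; exact: F0.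
by apply: eq_big_seq => i ir; rewrite FF'.
Qed.

Section output.
Context {R : realType} {dXi : measure_display} {Xi : measurableType dXi}
  {dO : measure_display} {Omega : measurableType dO} (P : probability Omega R)
  (mu : probability Xi R).
Variables (b : nat -> nat) (xi : nat * nat -> Omega -> Xi) (W : nat -> R)
  (k : nat) (rk : Omega -> nat).
Let J := sample_index b.
Hypothesis xi_iid : iid P mu J xi.
Hypothesis rk_output : random_output P J xi W k rk.

Let mrk : measurable_fun [set: Omega] rk := output_measurable rk_output.
Let rkm : {mfun Omega >-> nat} := HB.pack rk (isMeasurableFun.Build _ _ _ _ rk mrk).

Let mU : measurable_fun [set: Omega] (id : Omega -> history xi J).
Proof. by apply: (history_measurable_id xi_iid). Qed.

Let indep E B : measurable (E : set (history xi J)) -> measurable B ->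
  (P ((id : Omega -> history xi J) @^-1` E `&` rk @^-1` B) =
   P ((id : Omega -> history xi J) @^-1` E) * distribution P rkm B)%E.
Proof.
by move=> mE mB; have := output_indep rk_output B mE; rewrite setIC muleC.
Qed.

(** The event rk = s is independent of all samples, hence of h. *)
Lemma output_term (s : nat) (h : Omega -> R) :
  measurable_fun [set: history xi J] (h : history xi J -> R) -> (forall w, 0 <= h w) ->
  (\int[P]_w (\1_[set s] (rk w) * h w)%:E =
   P (rk @^-1` [set s]) * \int[P]_w (h w)%:E)%E.
Proof.
move=> mh h0.
pose H (p : history xi J * nat) : \bar R := (\1_[set s] p.2 * h p.1)%:E.
have mH : measurable_fun setT H.
  apply/measurable_EFinP; apply: measurable_funM.
    exact: (measurableT_comp (measurable_indic _) measurable_snd).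
  exact: (measurableT_comp mh measurable_fst).
have H0 p : (0 <= H p)%E by rewrite lee_fin mulr_ge0.
rewrite [LHS](freeze_ge0 mU mrk indep mH H0).
have mhO : measurable_fun [set: Omega] h by exact: (measurableT_comp mh mU).
rewrite -ge0_integralZl//; last 2 first.
- exact/measurable_EFinP.
- by move=> w _; rewrite lee_fin.
apply: eq_integral => w _; rewrite /H /=.
under eq_integral do rewrite EFinM muleC.
rewrite ge0_integralZl// ?lee_fin//; first by rewrite integral_indic// setIT muleC.
Qed.

(** On the event rk = t - 1 the left-hand integrand is h t.-1; by the range
    of rk exactly one of these events occurs. *)
Lemma output_expectation (h : nat -> Omega -> R) :
  (forall s, measurable_fun [set: history xi J] (h s : history xi J -> R)) ->
  (forall s w, 0 <= h s w) ->
  (forall t, (2 <= t <= k)%N -> 0 <= (\sum_(2 <= j < k.+1) W j)^-1 * W t) ->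
  ('E_P[fun w => h (rk w) w] =
   'E_P[fun w => ((\sum_(2 <= j < k.+1) W j)^-1 *
     \sum_(2 <= t < k.+1) W t * h t.-1 w)%R])%E.
Proof.
move=> mh h0 pmf0; rewrite unlock.
have mhO s : measurable_fun [set: Omega] (h s) by exact: (measurableT_comp (mh s) mU).
transitivity (\int[P]_w (\sum_(2 <= t < k.+1)
    (\1_[set t.-1] (rk w) * h t.-1 w)%:E)%E)%E.
  apply: eq_integral => w _; rewrite sumEFin; congr (_%:E).
  have /andP[r1 rk1] := output_range rk_output w.
  have rin : (rk w).+1 \in index_iota 2 k.+1.
    by rewrite mem_index_iota !ltnS r1; case: (k) rk1 r1 => [|m] //=; case: (rk w).
  rewrite (bigD1_seq _ rin) ?iota_uniq//= indicE mem_set// mul1r.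
  rewrite big1_seq ?addr0// => t /andP[tr]; rewrite mem_index_iota => /andP[t2 _].
  rewrite indicE memNset ?mul0r//= => rkt; move: tr; rewrite rkt prednK ?eqxx//.
  exact: ltnW.
rewrite ge0_integral_sum_seq; last 2 first.
- move=> t _; apply/measurable_EFinP; apply: measurable_funM => //.
  exact: (measurableT_comp (measurable_indic _) mrk).
- by move=> t w _; rewrite lee_fin mulr_ge0.
rewrite [RHS](_ : _ = (\int[P]_w (\sum_(2 <= t < k.+1)
    ((\sum_(2 <= j < k.+1) W j)^-1 * W t * h t.-1 w)%:E)%E)%E); last first.
  apply: eq_integral => w _; rewrite sumEFin mulr_sumr.
  by congr (_%:E); apply: eq_bigr => t _; rewrite mulrA.
rewrite ge0_integral_sum_seq; last 2 first.
- move=> t _; apply/measurable_EFinP; exact: measurable_funM.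
- move=> t w; rewrite mem_index_iota ltnS => t2k; rewrite lee_fin mulr_ge0//.
  exact: pmf0.
apply: eq_big_seq => t; rewrite mem_index_iota ltnS => t2k.
rewrite output_term// (output_pmf rk_output t2k).
under [RHS]eq_integral do rewrite EFinM.
rewrite ge0_integralZl//; last 3 first.
- exact/measurable_EFinP.
- by move=> w _; rewrite lee_fin.
- by rewrite lee_fin pmf0.
Qed.

End output.

(** * The general bound *)

Section bound.
Context {R : realType} {n : nat}.
Variables (X : set 'rV[R]_n) (f : 'rV[R]_n -> R) (gradf : 'rV[R]_n -> 'rV[R]_n).
Variables (L l gamma sigma : R).
Hypotheses (X0 : X !=set0) (Xconvex : convex_set (M := 'rV[R]_n) X)
  (Xcompact : compact X) (fC1 : is_gradient_on X f gradf)
  (fL : lipschitz_gradient X gradf L) (fl : lower_curvature X f gradf l).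
Hypotheses (L0 : 0 <= L) (l0 : 0 <= l) (Lgamma : L < gamma).
Context {dXi : measure_display} {Xi : measurableType dXi} (mu : probability Xi R)
  (G : 'rV[R]_n -> Xi -> 'rV[R]_n).
Hypothesis G_oracle : stochastic_oracle X gradf mu G sigma.
Context {dO : measure_display} {Omega : measurableType dO} (P : probability Omega R).
Variables (b : nat -> nat) (xi : nat * nat -> Omega -> Xi) (x0 : 'rV[R]_n).
Hypotheses (b_gt0 : forall t, (1 <= t)%N -> (0 < b t)%N) (x0X : X x0).
Hypothesis xi_iid : iid P mu (sample_index b) xi.
Variables (k : nat) (rk : Omega -> nat).
Hypotheses (k_ge2 : (2 <= k)%N)
  (rk_output : random_output P (sample_index b) xi (weight gamma L) k rk).

Let gamma0 : 0 < gamma. Proof. exact: le_lt_trans Lgamma. Qed.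
Let x := spg X G (fun=> gamma) b xi x0.
Let xX t w : X (x t w). Proof. exact: (spg_in _ X0 Xcompact). Qed.
Let gX t w := projected_gradient X (x t w) (gradf (x t w)) gamma.

Lemma gradient_minimizer : exists2 xs, X xs & forall y, X y -> f xs <= f y.
Proof.
have [xs] := EVT_min_rV X0 Xcompact (gradient_continuous fC1).
by rewrite inE => Xxs xsm; exists xs => // y Xy; apply: xsm; rewrite inE.
Qed.

Lemma noise_weight_ge0 t : (2 <= t)%N -> 0 <= noise_weight L gamma t.
Proof.
move=> t2.
have -> : noise_weight L gamma t =
    ((7 * t%:R - 2) * gamma - 2 * t%:R * L) / (4 * gamma ^+ 2).
  by rewrite /noise_weight; field; rewrite gt_eqF.
apply: divr_ge0; last by rewrite mulr_ge0// exprn_ge0// ltW.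
have T2 : 2 <= t%:R :> R by rewrite ler_nat.
have h1 : 0 <= (5 * t%:R - 2) * gamma by rewrite mulr_ge0 ?(ltW gamma0)//; lra.
have h2 : 0 <= t%:R * (gamma - L) by rewrite mulr_ge0// subr_ge0 ltW.
lra.
Qed.


Lemma weight_sum_gt0 : 0 < \sum_(2 <= t < k.+1) weight gamma L t.
Proof.
rewrite big_nat_recr//=; apply: ltr_wpDl; last exact: weight_gt0.
by rewrite big_seq sumr_ge0// => t; rewrite mem_index_iota => /andP[t2 _];
  exact/ltW/weight_gt0.
Qed.

(** The pathwise bound is integrated term by term; the inner products with
    xs - x_{t-1} have mean zero and disappear. *)
Lemma spg_bound :
  ('E_P[fun w => (enorm (gX (rk w) w) ^+ 2)%R] <=
    ((\sum_(2 <= t < k.+1) weight gamma L t)^-1 *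
     ((gamma / 2 + L / 4 + l * k%:R / 2) * diameter X ^+ 2 +
      \sum_(2 <= t < k.+1) noise_weight L gamma t * (sigma ^+ 2 / (b t)%:R) +
      sigma ^+ 2 / (gamma * (b 1%N)%:R)))%R%:E)%E.
Proof.
have [xs Xxs xsm] := gradient_minimizer.
have S0 := weight_sum_gt0.
have S0' := ltW S0; rewrite -invr_ge0 in S0'.
pose J := sample_index b.
have mx s : vec_measurable (x s : history xi J -> _).
  exact: (history_iterate X0 Xconvex Xcompact gamma0 G_oracle x0X).
have mg s : vec_measurable (fun w : history xi J => gX s w).
  have mgr := measurable_gradient X0 Xconvex Xcompact fL L0
    (T := history xi J) (xX s) (mx s).
  apply: vec_measurableZ; apply: vec_measurableB => //.
  exact: (measurable_prox X0 Xconvex Xcompact gamma0).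
have mh s : measurable_fun [set: history xi J]
    ((fun w => enorm (gX s w) ^+ 2) : history xi J -> R).
  exact: measurable_enorm_sqr.
rewrite (output_expectation xi_iid rk_output mh); last 2 first.
- by move=> s w; exact: sqr_ge0.
- by move=> t /andP[t2 _]; rewrite mulr_ge0// ltW// weight_gt0.
have mhO s : measurable_fun [set: Omega] (fun w => enorm (gX s w) ^+ 2).
  apply: (measurableT_comp (mh s)); exact: (history_measurable_id xi_iid).
have pb w := pathwise_bound X0 Xconvex Xcompact fC1 fL fl L0 l0 Lgamma
  (fun t => xX t w) (g := fun t => minibatch G b xi t (x t.-1 w) w)
  (fun t => erefl) Xxs xsm (ltnW k_ge2).
apply: (expectation_le_mean _ _ (fun w => ler_wpM2l S0' (pb w))).
- apply: measurable_funM => //; apply: measurable_sum => t.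
  by apply: measurable_funM; [exact: measurable_cst|exact: mhO].
- move=> w; rewrite mulr_ge0// big_seq sumr_ge0// => t; rewrite mem_index_iota.
  by move=> /andP[t2 _]; rewrite mulr_ge0 ?sqr_ge0// ltW// weight_gt0.
pose err := minibatch_error X gradf gamma G b xi x0.
have var t : (1 <= t)%N ->
    mean_le P (fun w => enorm (err t w) ^+ 2) (sigma ^+ 2 / (b t)%:R).
  exact: (minibatch_error_variance X0 Xconvex Xcompact fL L0 gamma0 G_oracle
    b_gt0 x0X xi_iid).
have mean0 t : (1 <= t)%N ->
    mean_le P (fun w => dotp (err t w) (xs - x t.-1 w)) 0.
  move=> t1.
  exact: (minibatch_error_mean0 X0 Xconvex Xcompact fL L0 gamma0 G_oracle
    b_gt0 x0X xi_iid).
apply: mean_leZ => //.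
set B := (X in mean_le _ _ X).
apply: (@mean_leW _ _ _ _ _ (B + \sum_(1 <= t < k.+1) 0)).
  by rewrite big1// addr0.
apply: mean_leD; last first.
  by apply: mean_le_sum => t; rewrite mem_index_iota => /andP[t1 _]; exact: mean0.
apply: mean_leD.
  apply: mean_leD; first exact: mean_le_cst.
  apply: mean_le_sum => t; rewrite mem_index_iota => /andP[t2 _].
  by apply: mean_leZ; [exact: noise_weight_ge0|apply: var; exact: ltnW].
under eq_fun do rewrite mulrC.
rewrite invfM mulrCA; apply: mean_leZ; first by rewrite invr_ge0 ltW.
exact: var.
Qed.

End bound.

(** * The prescribed batch sizes *)

Section batch_sizes.
Context {R : realType}.
Variables (L l D sigma : R) (k : nat) (b : nat -> nat).
Hypotheses (L0 : 0 < L) (l0 : 0 <= l) (D0 : 0 < D) (k_ge2 : (2 <= k)%N).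
Hypothesis b_gt0 : forall t, (1 <= t)%N -> (0 < b t)%N.
Hypothesis b_rule : forall t, (1 <= t)%N -> (b t)%:Z = batch_rule L l D sigma k t.

Let k0 : 0 < k%:R :> R. Proof. by rewrite ltr0n (leq_trans _ k_ge2). Qed.

(** Whichever entry of the minimum is attained, b_t is at least
    3 t sigma^2 / (4 L c) with c = l D^2 or c = L D^2 / k, and then the left-hand
    side is at most c. *)
Lemma batch_noise t : (1 <= t)%N ->
  (3 * t%:R - 1) / (4 * L) * (sigma ^+ 2 / (b t)%:R) <=
  l * D ^+ 2 + L * D ^+ 2 / k%:R.
Proof.
move=> t1; have t0 : 0 < t%:R :> R by rewrite ltr0n.
have b0 : 0 < (b t)%:R :> R by rewrite ltr0n b_gt0.
have lD0 : 0 <= l * D ^+ 2 by rewrite mulr_ge0// sqr_ge0.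
have LD0 : 0 <= L * D ^+ 2 / k%:R.
  by rewrite divr_ge0 ?mulr_ge0 ?sqr_ge0// ltW.
have s0 : 0 <= sigma ^+ 2 by exact: sqr_ge0.
suff H c : 0 <= c -> 3 * t%:R * sigma ^+ 2 <= 4 * L * c * (b t)%:R ->
    (3 * t%:R - 1) / (4 * L) * (sigma ^+ 2 / (b t)%:R) <= c.
  have ceil_le (y : R) : Num.ceil y <= (b t)%:Z -> y <= (b t)%:R.
    by move=> yb; rewrite -[_%:R]/((b t)%:Z%:~R) -ceil_le_int.
  have case1 : l != 0 ->
      Num.ceil (3 * t%:R * sigma ^+ 2 / (4 * L * l * D ^+ 2)) <= (b t)%:Z ->
      3 * t%:R * sigma ^+ 2 <= 4 * L * (l * D ^+ 2) * (b t)%:R.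
    move=> ln0 /ceil_le; rewrite ler_pdivrMr; first by lra.
    by rewrite !mulr_gt0// lt_def ln0.
  have case2 :
      Num.ceil (3 * t%:R * k%:R * sigma ^+ 2 / (4 * L ^+ 2 * D ^+ 2)) <= (b t)%:Z ->
      3 * t%:R * sigma ^+ 2 <= 4 * L * (L * D ^+ 2 / k%:R) * (b t)%:R.
    move=> /ceil_le; rewrite ler_pdivrMr ?mulr_gt0// ?exprn_gt0// => h.
    rewrite -(ler_pM2r k0).
    have -> : 4 * L * (L * D ^+ 2 / k%:R) * (b t)%:R * k%:R =
      (b t)%:R * (4 * L ^+ 2 * D ^+ 2) by field; rewrite gt_eqF.
    by apply: le_trans h; rewrite mulrAC.
  have := b_rule t1; rewrite /batch_rule => bE.
  have : Num.max 1 (if l == 0 then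
    Num.ceil (3 * t%:R * k%:R * sigma ^+ 2 / (4 * L ^+ 2 * D ^+ 2)) else
    Num.min (Num.ceil (3 * t%:R * sigma ^+ 2 / (4 * L * l * D ^+ 2)))
    (Num.ceil (3 * t%:R * k%:R * sigma ^+ 2 / (4 * L ^+ 2 * D ^+ 2)))) <= (b t)%:Z.
    by rewrite bE.
  rewrite ge_max => /andP[_]; case: ifPn => [_ /case2 h|ln0].
    by rewrite (le_trans (H _ LD0 h))// lerDr.
  rewrite ge_min => /orP[/(case1 ln0) h|/case2 h].
    by rewrite (le_trans (H _ lD0 h))// lerDl.
  by rewrite (le_trans (H _ LD0 h))// lerDr.
move=> c0 h; rewrite mulf_div ler_pdivrMr ?mulr_gt0//.
rewrite [leRHS]mulrCA -[leRHS]mulrA; lra.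
Qed.

(** For gamma = 2 L the weight W(t) is (t - 1) / (8 L). *)
Lemma weight_sum_doubled : \sum_(2 <= t < k.+1) weight (2 * L) L t =
  k%:R * (k%:R - 1) / (16 * L).
Proof.
have Ln0 : L != 0 by rewrite gt_eqF.
elim: k k_ge2 => // -[//|[_ _|m IH _]].
  by rewrite big_nat1 /weight; field.
by rewrite big_nat_recr//= IH// /weight -[m.+3%:R]natr1; field.
Qed.

(** For gamma = 2 L the noise weight is (3 t - 1) / (4 L), and its value at t = 1
    is the factor 1 / gamma of the first batch.  Thus k terms, each at most
    l D^2 + L D^2 / k, are added. *)
Lemma batch_bound :
  (\sum_(2 <= t < k.+1) weight (2 * L) L t)^-1 *
     ((2 * L / 2 + L / 4 + l * k%:R / 2) * D ^+ 2 +
      \sum_(2 <= t < k.+1) noise_weight L (2 * L) t * (sigma ^+ 2 / (b t)%:R) +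
      sigma ^+ 2 / (2 * L * (b 1%N)%:R)) <=
  40 * L ^+ 2 * D ^+ 2 / (k%:R * (k%:R - 1)) + 24 * L * l * D ^+ 2 / (k%:R - 1).
Proof.
have Ln0 : L != 0 by rewrite gt_eqF.
have k1 : 0 < k%:R - 1 :> R by rewrite subr_gt0 ltr1n.
have kk0 : 0 < k%:R * (k%:R - 1) :> R by rewrite mulr_gt0.
rewrite weight_sum_doubled invf_div mulrAC ler_pdivrMr//.
have noise : \sum_(2 <= t < k.+1) noise_weight L (2 * L) t * (sigma ^+ 2 / (b t)%:R) +
    sigma ^+ 2 / (2 * L * (b 1%N)%:R) <= k%:R * (l * D ^+ 2) + L * D ^+ 2.
  have bn0 : (b 1%N)%:R != 0 :> R by rewrite pnatr_eq0 -lt0n b_gt0.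
  apply: (@le_trans _ _ (\sum_(1 <= t < k.+1) (l * D ^+ 2 + L * D ^+ 2 / k%:R))).
    rewrite [leRHS]big_ltn ?ltnS 1?ltnW// addrC lerD//.
      apply: le_trans (batch_noise (leqnn 1)).
      by rewrite le_eqVlt; apply/orP; left; apply/eqP; field; rewrite bn0.
    rewrite big_seq [leRHS]big_seq ler_sum// => t; rewrite mem_index_iota => /andP[t2 _].
    apply: le_trans (batch_noise (ltnW t2)).
    rewrite /noise_weight le_eqVlt; apply/orP; left; apply/eqP; congr (_ * _); field.
    exact: Ln0.
  rewrite sumr_const_nat subn1 /= -[leLHS]mulr_natl mulrDr lerD2l mulrCA mulfV ?mulr1//.
  by rewrite gt_eqF.
rewrite -addrA.
have -> : (40 * L ^+ 2 * D ^+ 2 / (k%:R * (k%:R - 1)) +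
    24 * L * l * D ^+ 2 / (k%:R - 1)) * (k%:R * (k%:R - 1)) =
  16 * L * ((5 / 2 * L + 3 / 2 * l * k%:R) * D ^+ 2).
  by field; rewrite !gt_eqF.
rewrite ler_pM2l ?mulr_gt0//.
have : 0 <= L * D ^+ 2 by rewrite mulr_ge0 ?sqr_ge0// ltW.
lra.
Qed.

End batch_sizes.

Theorem theorem3 (R : realType) (n : nat) (X : set 'rV[R]_n)
  (f : 'rV[R]_n -> R) (gradf : 'rV[R]_n -> 'rV[R]_n) (L l sigma : R)
  (dXi : measure_display) (Xi : measurableType dXi) (mu : probability Xi R)
  (G : 'rV[R]_n -> Xi -> 'rV[R]_n)
  (dO : measure_display) (Omega : measurableType dO) (P : probability Omega R)
  (xi : nat * nat -> Omega -> Xi)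
  (gamma : R) (b : nat -> nat) (x0 : 'rV[R]_n) (k : nat) (rk : Omega -> nat)
  (X_nonempty : X !=set0)
  (X_convex : convex_set (M := 'rV[R]_n) X)
  (X_compact : compact X)
  (L_ge0 : 0 <= L)
  (l_bounds : 0 <= l <= L)
  (f_C1 : C1_on X f gradf)
  (f_smooth : lipschitz_gradient X gradf L)
  (f_lower : lower_curvature X f gradf l)
  (sigma_gt0 : 0 < sigma ^+ 2)
  (G_oracle : stochastic_oracle X gradf mu G sigma)
  (b_gt0 : forall t, (1 <= t)%N -> (0 < b t)%N)
  (xi_iid : iid P mu (sample_index b) xi)
  (x0_X : X x0)
  (gamma_gt_L : L < gamma)
  (k_ge2 : (2 <= k)%N)
  (rk_output :
    random_output P (sample_index b) xi (weight gamma L) k rk) :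
  let x := spg X G (fun _ => gamma) b xi x0 in
  let gX t w := projected_gradient X (x t w) (gradf (x t w)) gamma in
  let D := diameter X in
  ('E_P[fun w => (enorm (gX (rk w) w) ^+ 2)%R] <=
    ((\sum_(2 <= t < k.+1)
        ((3 * t%:R - 2) / (8 * gamma) - t%:R * L / (4 * gamma ^+ 2)))^-1 *
     ((gamma / 2 + L / 4 + l * k%:R / 2) * D ^+ 2 +
      \sum_(2 <= t < k.+1)
        ((7 * t%:R - 2) / (4 * gamma) - t%:R * L / (2 * gamma ^+ 2)) *
          (sigma ^+ 2 / (b t)%:R) +
      sigma ^+ 2 / (gamma * (b 1%N)%:R)))%R%:E)%E
  /\
  (gamma = 2 * L -> 0 < L -> 0 < D ->
   (forall t, (1 <= t)%N -> (b t)%:Z = batch_rule L l D sigma k t) ->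
   ('E_P[fun w => (enorm (gX (rk w) w) ^+ 2)%R] <=
     (40 * L ^+ 2 * D ^+ 2 / (k%:R * (k%:R - 1)) +
      24 * L * l * D ^+ 2 / (k%:R - 1))%R%:E)%E).
Proof.
have gamma0 : 0 < gamma by exact: le_lt_trans gamma_gt_L.
have [l0 _] := andP l_bounds.
have B := spg_bound X_nonempty X_convex X_compact f_C1.1 f_smooth f_lower L_ge0 l0
  gamma_gt_L G_oracle b_gt0 x0_X xi_iid k_ge2 rk_output.
split; first exact: B.
move=> gE Lgt0 Dgt0 b_rule; apply: le_trans B _; rewrite lee_fin gE.
exact: batch_bound.
Qed.
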